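(* For every $k\in\mathbb Z$, $\Lambda_k$ is a smooth bounded function on $\mathbb R$ with $\Lambda_k(t)\to1$ as $t\to-\infty$ and $\Lambda_k(t)\to0$ as $t\to+\infty$, and the function $v_k(x,z):=r^{\frac12+3k}\Lambda_k(t)$, with $r=(z^2+x^{2/3})^{1/2}$ and $t=zx^{-1/3}$, satisfies $z\partial_xv_k-\partial_{zz}v_k=0$ in $(0,\infty)\times\mathbb R$ and $v_k(0,z)=0$ for $z>0$ (as a limit $x\to0^+$).
   Context: Let $M(a,b,\zeta)=\sum_{n\ge0}\frac{(a)_n}{(b)_n}\frac{\zeta^n}{n!}$ be Kummer's confluent hypergeometric function ($(a)_n$ the rising factorial). For $k\in\mathbb Z$ define $$\Lambda_k(t)=9^{\frac16+k}(1+t^2)^{-\frac14-\frac{3k}2}\Big[\tfrac{\Gamma(1/3)}{\Gamma(1/6-k)}M\big(-\tfrac16-k,\tfrac23,-\tfrac{t^3}{9}\big)-\tfrac{t}{9^{1/3}}\tfrac{\Gamma(-1/3)}{\Gamma(-1/6-k)}M\big(\tfrac16-k,\tfrac43,-\tfrac{t^3}{9}\big)\Big].$$ *)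

(* Defs.v *)
From Stdlib Require Import Reals ZArith.
From Coquelicot Require Import Coquelicot.
Open Scope R_scope.

Fixpoint rising (a : R) (n : nat) : R :=
  match n with
  | O => 1
  | S m => rising a m * (a + INR m)
  end.

(* Euler's Gamma function via Gauss's limit formula
   Gamma x = lim_n n! n^x / (x (x+1) ... (x+n)),
   valid for every x not in {0,-1,-2,...}. *)
Definition Gamma (x : R) : R :=
  real (Lim_seq (fun n => INR (fact n) * Rpower (INR n) x / rising x (S n))).

Definition KummerM (a b zeta : R) : R :=
  Series (fun n => rising a n / rising b n * zeta ^ n / INR (fact n)).

Definition Lambda (k : Z) (t : R) : R :=
  Rpower 9 (1/6 + IZR k) * Rpower (1 + t^2) (-(1/4) - 3 * IZR k / 2) *
  ( Gamma (1/3) / Gamma (1/6 - IZR k)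
      * KummerM (-(1/6) - IZR k) (2/3) (- t^3 / 9)
    - t / Rpower 9 (1/3) * (Gamma (-(1/3)) / Gamma (-(1/6) - IZR k))
      * KummerM (1/6 - IZR k) (4/3) (- t^3 / 9) ).

Definition vk (k : Z) (x z : R) : R :=
  Rpower (sqrt (z^2 + Rpower x (2/3))) (1/2 + 3 * IZR k)
  * Lambda k (z * Rpower x (-(1/3))).

(* Main.v *)
Require Import Defs.
From Stdlib Require Import Reals ZArith Lra Lia.
From Coquelicot Require Import Coquelicot.
Open Scope R_scope.

(** With [y = |t|^3/9], [Lambda k t] is, up to a factor tending to [1], equal to
    [y^a U(a, 2/3, y)] for [t < 0], where [a = -1/6 - k] and [U] is Tricomi's
    function, and to the same combination of Kummer functions continued to
    [-y] for [t > 0].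

    The Gauss limit gives [(a)_n/(b)_n ~ Gamma b/Gamma a * n^(a-b)], and
    concentration of the Poisson law of mean [y] turns this into
    [M(a,b,y) ~ Gamma b/Gamma a * e^y y^(a-b)].  With Kummer's transformation
    this settles [t -> +oo], where the leading terms cancel because
    [Gamma x * Gamma (1 - x)] only changes sign under [x -> x + 1].  At
    [t -> -oo] the dominant exponentials cancel too, and the subdominant
    behaviour [U ~ y^-a] is recovered from the Wronskian of the two Kummer
    solutions by L'Hopital's rule.  The differential equation for [v_k] reduces,
    by homogeneity, to Kummer's equation. *)

(** * The Gamma function at non-integers *)

(** [Gamma] is the [real] part of a [Lim_seq], so nothing can be said about it before Gauss's
    sequence is known to converge to a finite limit. Convergence, nonvanishing and the recursion at
    non-integers are all that the argument takes from it; Euler's integral and the sine formula do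
    not enter.

    The parameter [-1/6 - k] takes both signs, so integral representations of [M] and [U], valid
    only for parameters in a half-line, would not serve all [k] at once. The Poisson argument looks
    only at the tail of the coefficients and is indifferent to signs. It works directly for growth
    exponents in [[0,1]], where a second moment suffices; shifting the summation index by one
    changes the exponent by one and reaches every real exponent.

    That argument gives the leading term [e^y y^(a-b)] up to a relative error tending to zero. Such
    an error is still exponentially larger than [y^-a], so subtracting two leading terms reveals
    nothing about [U]. This is why an exact identity, the Wronskian, has to carry the limit at
    [-oo]. *)

(** Excluding all integers, and not only the poles of [Gamma], makes the condition stable under
    negation and integer shifts, so it passes through recursions and reflections alike. *)
Definition nonint (x : R) : Prop := forall m : Z, x <> IZR m.

Lemma nonint_plus_IZR (x : R) (m : Z) : nonint x -> nonint (x + IZR m).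
Proof.
  intros Hx p E; apply (Hx (p - m)%Z); rewrite minus_IZR; lra.
Qed.

Lemma nonint_opp (x : R) : nonint x -> nonint (- x).
Proof.
  intros Hx p E; apply (Hx (- p)%Z); rewrite opp_IZR; lra.
Qed.

Lemma nonint_succ (x : R) : nonint x -> nonint (x + 1).
Proof. exact (nonint_plus_IZR x 1). Qed.

Lemma nonint_plus_INR_neq0 (x : R) (n : nat) : nonint x -> x + INR n <> 0.
Proof.
  intros Hx E; apply (Hx (- Z.of_nat n)%Z); rewrite opp_IZR, <- INR_IZR_INZ; lra.
Qed.

Lemma rising_neq0 (x : R) (n : nat) : nonint x -> rising x n <> 0.
Proof.
  intros Hx; induction n as [|n IH]; cbn [rising]; [lra|].
  apply Rmult_integral_contrapositive; split; [exact IH|].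
  now apply nonint_plus_INR_neq0.
Qed.

Lemma rising_pos (x : R) (n : nat) : 0 < x -> 0 < rising x n.
Proof.
  intros Hx; induction n as [|n IH]; cbn [rising]; [lra|].
  apply Rmult_lt_0_compat; [exact IH|]. pose proof (pos_INR n); lra.
Qed.

Lemma rising_S_l (x : R) (n : nat) : rising x (S n) = x * rising (x + 1) n.
Proof.
  induction n as [|n IH]; [cbn; ring|].
  change (rising x (S (S n))) with (rising x (S n) * (x + INR (S n))).
  rewrite IH, S_INR; cbn [rising]; ring.
Qed.

Lemma Rpower_pos (x y : R) : 0 < Rpower x y.
Proof. apply exp_pos. Qed.

Lemma INR_fact_pos (n : nat) : 0 < INR (fact n).
Proof. apply lt_0_INR, lt_O_fact. Qed.

Lemma fact_S_INR (n : nat) : INR (fact (S n)) = INR (S n) * INR (fact n).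
Proof. rewrite <- mult_INR; reflexivity. Qed.

Lemma INR_S_pos (n : nat) : 0 < INR (S n).
Proof. apply lt_0_INR; lia. Qed.

(* Average the two tangent inequalities [1 >= w^x (1 - x ln w)] and
   [w >= w^x (1 + (1 - x) ln w)] with weights [1 - x] and [x]. *)
Lemma Rpower_bernoulli (x w : R) :
  0 < w -> 0 <= x <= 1 -> Rpower w x <= 1 + x * (w - 1).
Proof.
  intros Hw Hx.
  set (p := Rpower w x); set (l := ln w).
  assert (Hp : 0 < p) by apply Rpower_pos.
  assert (H1 : p * (1 - x * l) <= 1).
  { replace 1 with (p * exp (- x * l)) at 2.
    - apply Rmult_le_compat_l; [lra|].
      pose proof (exp_ineq1_le (- x * l)); lra.
    - unfold p, Rpower; rewrite <- exp_plus; fold l.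
      replace (x * l + - x * l) with 0 by ring; apply exp_0. }
  assert (H2 : p * (1 + (1 - x) * l) <= w).
  { replace w with (p * exp ((1 - x) * l)) at 1.
    - apply Rmult_le_compat_l; [lra|].
      pose proof (exp_ineq1_le ((1 - x) * l)); lra.
    - unfold p, Rpower; rewrite <- exp_plus; fold l.
      replace (x * l + (1 - x) * l) with l by ring; apply exp_ln, Hw. }
  assert (H3 := Rmult_le_compat_l (1 - x) _ _ ltac:(lra) H1).
  assert (H4 := Rmult_le_compat_l x _ _ ltac:(lra) H2).
  nra.
Qed.

(** The sequence whose limit defines [Gamma x]. Estimates below are stated at [S n], because at
    [n = 0] the power of [INR 0] has only a conventional value. *)
Definition gauss (x : R) (n : nat) : R :=
  INR (fact n) * Rpower (INR n) x / rising x (S n).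

(** Bernoulli's inequality at [w = N/(N+1)] bounds [w^x (N+1+x)] by
    [(1 - x/(N+1)) (N+1+x) = N+1 - x^2/(N+1)], which is below [N+1]; this says that the quotient of
    consecutive terms is at least 1. *)
Lemma gauss_le_succ (x : R) (n : nat) :
  0 < x < 1 -> gauss x (S n) <= gauss x (S (S n)).
Proof.
  intros Hx; unfold gauss.
  change (rising x (S (S (S n)))) with (rising x (S (S n)) * (x + INR (S (S n)))).
  rewrite (fact_S_INR (S n)), (S_INR (S n)).
  assert (HN := INR_S_pos n); set (N := INR (S n)) in *.
  assert (HF := INR_fact_pos (S n)); set (F := INR (fact (S n))) in *.
  assert (HR := rising_pos x (S (S n)) ltac:(lra)); set (r := rising x (S (S n))) in *.
  assert (HP := Rpower_pos (N + 1) x); set (P := Rpower (N + 1) x) in *.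
  assert (HB := Rpower_bernoulli x (N / (N + 1)) ltac:(apply Rdiv_lt_0_compat; lra) ltac:(lra)).
  assert (E : Rpower N x = P * Rpower (N / (N + 1)) x).
  { unfold P; rewrite Rpower_mult_distr; [|lra|apply Rdiv_lt_0_compat; lra].
    f_equal; field; lra. }
  assert (H : Rpower N x * (x + (N + 1)) <= (N + 1) * P).
  { rewrite E.
    assert (Rpower (N / (N + 1)) x * (x + (N + 1)) <= N + 1).
    { apply Rle_trans with ((1 + x * (N / (N + 1) - 1)) * (x + (N + 1))).
      - apply Rmult_le_compat_r; lra.
      - replace ((1 + x * (N / (N + 1) - 1)) * (x + (N + 1)))
          with (N + 1 - x * x * / (N + 1)) by (field; lra).
        assert (0 < / (N + 1)) by (apply Rinv_0_lt_compat; lra).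
        assert (0 <= x * x) by nra. nra. }
    nra. }
  replace (F * Rpower N x / r) with (F / (r * (x + (N + 1))) * (Rpower N x * (x + (N + 1))))
    by (field; lra).
  replace ((N + 1) * F * P / (r * (x + (N + 1))))
    with (F / (r * (x + (N + 1))) * ((N + 1) * P)) by (field; lra).
  apply Rmult_le_compat_l; [|exact H].
  apply Rlt_le, Rdiv_lt_0_compat; [lra|apply Rmult_lt_0_compat; lra].
Qed.

(* [n! n^(x-1) / (x)_n] is the decreasing companion of Gauss's increasing sequence. *)
Lemma gauss_companion_le (x : R) (n : nat) :
  0 < x < 1 ->
  INR (fact (S n)) * Rpower (INR (S n)) x <= INR (S n) * rising x (S n) / x.
Proof.
  intros Hx; induction n as [|n IH].
  - cbn; unfold Rpower; rewrite ln_1, Rmult_0_r, exp_0.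
    right; field; lra.
  - change (rising x (S (S n))) with (rising x (S n) * (x + INR (S n))).
    rewrite (fact_S_INR (S n)), (S_INR (S n)).
    assert (HN := INR_S_pos n); set (N := INR (S n)) in *.
    assert (HF := INR_fact_pos (S n)); set (F := INR (fact (S n))) in *.
    set (r := rising x (S n)) in *.
    assert (HB := Rpower_bernoulli x ((N + 1) / N) ltac:(apply Rdiv_lt_0_compat; lra) ltac:(lra)).
    assert (E : Rpower (N + 1) x = Rpower N x * Rpower ((N + 1) / N) x).
    { rewrite Rpower_mult_distr; [|lra|apply Rdiv_lt_0_compat; lra].
      f_equal; field; lra. }
    assert (HP := Rpower_pos N x).
    replace ((N + 1) * (r * (x + N)) / x)
      with ((N + 1) * (N * r / x * ((x + N) / N))) by (field; lra).
    rewrite Rmult_assoc; apply Rmult_le_compat_l; [lra|].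
    rewrite E, <- Rmult_assoc.
    apply Rmult_le_compat; [nra|apply Rlt_le, Rpower_pos|exact IH|].
    eapply Rle_trans; [exact HB|right; field; lra].
Qed.

Lemma gauss_le (x : R) (n : nat) : 0 < x < 1 -> gauss x (S n) <= / x.
Proof.
  intros Hx; unfold gauss.
  change (rising x (S (S n))) with (rising x (S n) * (x + INR (S n))).
  assert (H := gauss_companion_le x n Hx).
  assert (HN := INR_S_pos n).
  assert (HR := rising_pos x (S n) ltac:(lra)).
  apply Rle_div_l; [apply Rmult_lt_0_compat; lra|].
  eapply Rle_trans; [exact H|].
  replace (/ x * (rising x (S n) * (x + INR (S n))))
    with (INR (S n) * rising x (S n) / x + rising x (S n)) by (field; lra).
  lra.
Qed.

(** A bounded increasing sequence; its limit is nonzero because it dominates the positive term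
    [gauss x 1]. *)
Lemma gauss_cvg_01 (x : R) :
  0 < x < 1 -> exists l : R, is_lim_seq (gauss x) l /\ l <> 0.
Proof.
  intros Hx.
  destruct (ex_finite_lim_seq_incr (fun n => gauss x (S n)) (/ x)) as [l Hl].
  - intros n; now apply gauss_le_succ.
  - intros n; now apply gauss_le.
  - exists l; split; [now apply is_lim_seq_incr_1|].
    assert (H0 := is_lim_seq_incr_compare _ _ Hl (fun n => gauss_le_succ x n Hx) 0%nat).
    cbn beta in H0.
    assert (0 < gauss x 1); [|lra].
    unfold gauss; apply Rdiv_lt_0_compat;
      [apply Rmult_lt_0_compat; [apply INR_fact_pos|apply Rpower_pos]|apply rising_pos; lra].
Qed.

Lemma is_lim_seq_ratio (a b : R) :
  is_lim_seq (fun n => (a + INR n) / (b + INR n)) 1.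
Proof.
  assert (Hi : is_lim_seq (fun n => / (b + INR n)) 0).
  { replace (Finite 0) with (Rbar_inv p_infty) by reflexivity.
    apply is_lim_seq_inv; [|discriminate].
    apply is_lim_seq_plus with (l1 := b) (l2 := p_infty);
      [apply is_lim_seq_const|apply is_lim_seq_INR|reflexivity]. }
  apply is_lim_seq_ext_loc with (fun n => 1 + (a - b) * / (b + INR n)).
  - destruct (nfloor_ex (Rabs b) (Rabs_pos b)) as [m Hm].
    exists (S m); intros n Hn.
    assert (INR (S m) <= INR n) by now apply le_INR.
    rewrite S_INR in *. pose proof (Rle_abs (- b)); rewrite Rabs_Ropp in *.
    field; lra.
  - replace (Finite 1) with (Finite (1 + (a - b) * 0)) by (f_equal; ring).
    apply is_lim_seq_plus'; [apply is_lim_seq_const|].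
    now apply is_lim_seq_mult'; [apply is_lim_seq_const|].
Qed.

Lemma gauss_shift (x : R) (n : nat) :
  nonint x -> gauss (x + 1) (S n) = gauss x (S n) * (x * (INR (S n) / (x + 1 + INR (S n)))).
Proof.
  intros Hx; unfold gauss.
  assert (E : rising x (S (S n)) * (x + 1 + INR (S n)) = x * rising (x + 1) (S (S n))).
  { rewrite <- rising_S_l.
    change (rising x (S (S (S n)))) with (rising x (S (S n)) * (x + INR (S (S n)))).
    rewrite (S_INR (S n)); ring. }
  assert (H1 := rising_neq0 x (S (S n)) Hx).
  assert (H2 := rising_neq0 (x + 1) (S (S n)) (nonint_succ x Hx)).
  assert (H3 := nonint_plus_INR_neq0 (x + 1) (S n) (nonint_succ x Hx)).
  assert (H4 := nonint_plus_INR_neq0 x 0 Hx); cbn in H4.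
  rewrite Rpower_plus, Rpower_1 by apply INR_S_pos.
  replace (rising (x + 1) (S (S n)))
    with (rising x (S (S n)) * (x + 1 + INR (S n)) / x) by (rewrite E; field; lra).
  field; repeat split; lra.
Qed.

Lemma gauss_cvg_succ (x l : R) :
  nonint x -> is_lim_seq (gauss x) l -> is_lim_seq (gauss (x + 1)) (x * l).
Proof.
  intros Hx Hl; apply is_lim_seq_incr_1.
  apply is_lim_seq_ext with
    (fun n => gauss x (S n) * (x * (INR (S n) / (x + 1 + INR (S n))))).
  { intros n; symmetry; now apply gauss_shift. }
  replace (x * l) with (l * (x * 1)) by ring.
  apply is_lim_seq_mult'; [now apply is_lim_seq_incr_1 in Hl|].
  apply is_lim_seq_mult'; [apply is_lim_seq_const|].
  apply (is_lim_seq_incr_1 (fun n => INR n / (x + 1 + INR n))).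
  apply is_lim_seq_ext with (fun n => (0 + INR n) / (x + 1 + INR n));
    [intros n; now rewrite Rplus_0_l|apply is_lim_seq_ratio].
Qed.

Lemma gauss_cvg_pred (x l : R) :
  nonint x -> is_lim_seq (gauss (x + 1)) l -> is_lim_seq (gauss x) (l / x).
Proof.
  intros Hx Hl; apply is_lim_seq_incr_1.
  assert (H4 := nonint_plus_INR_neq0 x 0 Hx); cbn in H4; rewrite Rplus_0_r in H4.
  apply is_lim_seq_ext with
    (fun n => gauss (x + 1) (S n) * (((x + 1 + INR (S n)) / (0 + INR (S n))) * / x)).
  { intros n; rewrite gauss_shift by exact Hx.
    assert (H3 := nonint_plus_INR_neq0 (x + 1) (S n) (nonint_succ x Hx)).
    assert (H5 := INR_S_pos n). field; lra. }
  replace (l / x) with (l * (1 * / x)) by (field; exact H4).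
  apply is_lim_seq_mult'; [now apply is_lim_seq_incr_1 in Hl|].
  apply is_lim_seq_mult'; [|apply is_lim_seq_const].
  apply (is_lim_seq_incr_1 (fun n => (x + 1 + INR n) / (0 + INR n))), is_lim_seq_ratio.
Qed.

(** The fractional part lies strictly between 0 and 1, and the recursion carries convergence from
    there up and down through the integers. Nonvanishing travels along because each factor met on
    the way is a non-integer, hence nonzero. *)
Lemma gauss_cvg (x : R) :
  nonint x -> exists l : R, is_lim_seq (gauss x) l /\ l <> 0.
Proof.
  intros Hx.
  assert (Hf : 0 < frac_part x < 1).
  { destruct (base_fp x) as [H0 H1]; split; [|exact H1].
    destruct (Rle_lt_or_eq_dec 0 (frac_part x)) as [H|H]; [lra|exact H|].
    exfalso; apply (Hx (Int_part x)); unfold frac_part in H; lra. }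
  assert (Hn : forall m : Z, nonint (frac_part x + IZR m)).
  { intros m p E; apply (Hx (Int_part x + p - m)%Z).
    rewrite minus_IZR, plus_IZR; unfold frac_part in E; lra. }
  replace x with (frac_part x + IZR (Int_part x)) by (unfold frac_part; ring).
  induction (Int_part x) as [|m [l [Hl Hl0]]|m [l [Hl Hl0]]] using Z.peano_ind.
  - rewrite Rplus_0_r; now apply gauss_cvg_01.
  - exists ((frac_part x + IZR m) * l).
    rewrite succ_IZR, <- Rplus_assoc; split; [now apply gauss_cvg_succ|].
    apply Rmult_integral_contrapositive; split; [exact (Hn m 0%Z)|exact Hl0].
  - exists (l / (frac_part x + IZR (Z.pred m))); split.
    + apply gauss_cvg_pred; [apply Hn|].
      now replace (frac_part x + IZR (Z.pred m) + 1) with (frac_part x + IZR m)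
        by (unfold Z.pred; rewrite plus_IZR; ring).
    + apply Rmult_integral_contrapositive; split; [exact Hl0|].
      apply Rinv_neq_0_compat, (Hn _ 0%Z).
Qed.

Lemma Gamma_unique (x l : R) : is_lim_seq (gauss x) l -> Gamma x = l.
Proof.
  intros Hl; change (real (Lim_seq (gauss x)) = l); now rewrite (is_lim_seq_unique _ _ Hl).
Qed.

Lemma is_lim_seq_Gamma (x : R) : nonint x -> is_lim_seq (gauss x) (Gamma x).
Proof.
  intros Hx; destruct (gauss_cvg x Hx) as [l [Hl _]].
  now rewrite (Gamma_unique x l Hl).
Qed.

Lemma Gamma_neq0 (x : R) : nonint x -> Gamma x <> 0.
Proof.
  intros Hx; destruct (gauss_cvg x Hx) as [l [Hl Hl0]].
  now rewrite (Gamma_unique x l Hl).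
Qed.

Lemma Gamma_succ (x : R) : nonint x -> Gamma (x + 1) = x * Gamma x.
Proof.
  intros Hx; apply Gamma_unique, gauss_cvg_succ; [exact Hx|now apply is_lim_seq_Gamma].
Qed.

(** * Exponential generating functions and the Poisson law *)

(** Times [exp (- y)], the sum of these terms is the expectation of [c N] for a Poisson variable [N]
    of mean [y]. *)
Definition egf_term (c : nat -> R) (y : R) (n : nat) : R := c n * y ^ n / INR (fact n).

Lemma is_series_exp (y : R) : is_series (egf_term (fun _ => 1) y) (exp y).
Proof.
  apply is_series_ext with (fun n => scal (y ^ n) (/ INR (fact n))).
  - intros n; unfold egf_term, scal; cbn; unfold mult; cbn; unfold Rdiv; ring.
  - assert (H := is_exp_Reals y); unfold is_pseries in H.
    eapply is_series_ext; [|exact H].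
    intros n; cbn beta; now rewrite pow_n_pow.
Qed.

(** The Poisson identity [E (N c(N-1)) = y E c(N)]. The factor [INR n] kills the term [n = 0], where
    [pred] is only a convention. *)
Lemma is_series_egf_mult (c : nat -> R) (y l : R) :
  is_series (egf_term c y) l ->
  is_series (egf_term (fun n => INR n * c (pred n)) y) (y * l).
Proof.
  intros H; apply is_series_decr_1.
  match goal with |- is_series _ ?m => replace m with (y * l) end.
  2:{ unfold egf_term, plus, opp; cbn; field. }
  apply is_series_ext with (fun n => scal y (egf_term c y n)).
  - intros n; unfold egf_term, scal; cbn [pred]; rewrite fact_S_INR.
    cbn -[INR fact]; unfold mult; cbn -[INR fact].
    pose proof (INR_S_pos n); pose proof (INR_fact_pos n); field; lra.
  - apply (is_series_scal y _ _ H).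
Qed.

(** The inverse shift, [E (c(N+1)/(N+1))]: dividing by [y] requires removing the constant term
    first. *)
Lemma is_series_egf_div (c : nat -> R) (y l : R) :
  y <> 0 -> is_series (egf_term c y) l ->
  is_series (egf_term (fun n => c (S n) / INR (S n)) y) ((l - c 0%nat) / y).
Proof.
  intros Hy H.
  apply is_series_ext with (fun n => scal (/ y) (egf_term c y (S n))).
  - intros n; unfold egf_term, scal; rewrite fact_S_INR.
    cbn -[INR fact]; unfold mult; cbn -[INR fact].
    pose proof (INR_S_pos n); pose proof (INR_fact_pos n); field; lra.
  - replace ((l - c 0%nat) / y) with (scal (/ y) (l - c 0%nat))
      by (unfold scal; cbn; unfold mult; cbn; field; exact Hy).
    apply (is_series_scal (/ y) (fun n => egf_term c y (S n)) (l - c 0%nat)).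
    apply is_series_incr_1.
    match goal with |- is_series _ ?m => replace m with l end; [exact H|].
    unfold plus, egf_term; cbn; field.
Qed.

Lemma is_series_Rabs_le (u v : nat -> R) (l m : R) :
  is_series u l -> is_series v m -> (forall n, Rabs (u n) <= v n) -> Rabs l <= m.
Proof.
  intros Hu Hv H.
  assert (Ha : ex_series (fun n => Rabs (u n))).
  { apply (ex_series_le (fun n => Rabs (u n)) v); [|now exists m].
    intros n; unfold norm; cbn; unfold abs; cbn; rewrite Rabs_Rabsolu; apply H. }
  rewrite <- (is_series_unique _ _ Hu), <- (is_series_unique _ _ Hv).
  eapply Rle_trans; [apply Series_Rabs, Ha|].
  apply Series_le; [|now exists m].
  intros n; split; [apply Rabs_pos|apply H].
Qed.

(** * Poisson averages of sequences of power growth *)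

(** For [s] in [[0,1]] the power [w^s] lies between 1 and [w]. *)
Lemma Rpower_dist_1 (s w : R) : 0 < w -> 0 <= s <= 1 -> Rabs (Rpower w s - 1) <= Rabs (w - 1).
Proof.
  intros Hw Hs.
  assert (H := Rpower_bernoulli s w Hw Hs).
  destruct (Rle_lt_dec 1 w) as [H1|H1].
  - assert (1 <= Rpower w s) by (rewrite <- (Rpower_O w) by lra; apply Rle_Rpower; lra).
    rewrite !Rabs_pos_eq by lra; nra.
  - assert (Rpower w s <= 1) by nra.
    assert (w <= Rpower w s).
    { rewrite <- (Rpower_1 w) at 1 by exact Hw.
      destruct (Req_dec s 1) as [->|Hs1]; [apply Rle_refl|].
      apply Rlt_le, exp_increasing.
      assert (ln w < 0) by (rewrite <- ln_1; apply ln_increasing; lra). nra. }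
    rewrite !Rabs_left1 by lra; lra.
Qed.

Lemma eventually_bounded (v : nat -> R) (N : nat) :
  (forall n, (N <= n)%nat -> v n <= 0) -> exists K, 0 <= K /\ forall n, v n <= K.
Proof.
  intros H.
  assert (HK : exists K, 0 <= K /\ forall n, (n < N)%nat -> v n <= K).
  { clear H; induction N as [|N [K [HK0 HK]]]; [exists 0; split; [lra|lia]|].
    exists (Rmax K (v N)); split; [eapply Rle_trans; [exact HK0|apply Rmax_l]|].
    intros n Hn; destruct (Nat.eq_dec n N) as [->|Hne]; [apply Rmax_r|].
    eapply Rle_trans; [apply HK; lia|apply Rmax_l]. }
  destruct HK as [K [HK0 HK]]; exists K; split; [exact HK0|].
  intros n; destruct (le_lt_dec N n) as [Hn|Hn]; [specialize (H n Hn); lra|now apply HK].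
Qed.

(** The product is [exp (y (p ln y / y - 1))], and [ln y / y] tends to 0. *)
Lemma is_lim_exp_neg_Rpower (p : R) :
  is_lim (fun y => exp (- y) * Rpower y p) p_infty 0.
Proof.
  apply is_lim_ext_loc with (fun y => exp (y * (p * (ln y / y) - 1))).
  - exists 0; intros y Hy; unfold Rpower; rewrite <- exp_plus; f_equal; field; lra.
  - apply is_lim_comp with m_infty; [apply is_lim_exp_m| |exists 0; intros y _; discriminate].
    replace m_infty with (Rbar_mult p_infty (-1)).
    2:{ unfold Rbar_mult, Rbar_mult'; destruct (Rle_dec 0 (-1)) as [H|H]; [exfalso; lra|reflexivity]. }
    apply is_lim_mult; [apply is_lim_id| |cbn; lra].
    replace (-1) with (p * 0 - 1) by ring.
    apply is_lim_minus'; [|apply is_lim_const].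
    apply is_lim_scal_l with (a := p) (l := 0), is_lim_div_ln_p.
Qed.

(** Poisson averaging preserves power asymptotics of exponent [s]. Quantifying over [c] inside lets
    the exponent be shifted by passing to another sequence; the base [S n] makes the term [n = 0] a
    genuine power. *)
Definition poisson_limit (s : R) : Prop :=
  forall (c : nat -> R) (kappa : R),
    (forall y, 0 < y -> ex_series (egf_term c y)) ->
    is_lim_seq (fun n => c n / Rpower (INR (S n)) s) kappa ->
    is_lim (fun y => Series (egf_term c y) * exp (- y) * Rpower y (- s)) p_infty kappa.

(* The second moment of a Poisson variable [N] of mean [y]:
   [E (N + 1 - y)^2 = y + 1]. *)
Lemma is_series_poisson_bound (A B C K y : R) :
  0 < y ->
  is_series
    (egf_term (fun n => A + B * (INR (S n) / y) + C * (INR (S n) / y - 1) ^ 2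
                        + K / INR (S n)) y)
    (exp y * (A + B * ((y + 1) / y) + C * ((y + 1) / y ^ 2)) + K * ((exp y - 1) / y)).
Proof.
  intros Hy.
  assert (H0 := is_series_exp y).
  assert (H1 := is_series_egf_mult _ _ _ H0).
  assert (H2 := is_series_egf_mult _ _ _ H1).
  assert (H3 := is_series_egf_div _ y _ ltac:(lra) H0).
  (* The quadratic in [n] is expanded in [1], [n], [n(n-1)], whose Poisson means are [1], [y],
     [y^2]; [L3] handles the reciprocal term. *)
  assert (L0 := is_series_scal (A + B / y + C * (1 / y - 1) ^ 2) _ _ H0).
  assert (L1 := is_series_scal (B / y + C * (2 / y * (1 / y - 1) + 1 / y ^ 2)) _ _ H1).
  assert (L2 := is_series_scal (C / y ^ 2) _ _ H2).
  assert (L3 := is_series_scal K _ _ H3).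
  assert (L := is_series_plus _ _ _ _ (is_series_plus _ _ _ _ (is_series_plus _ _ _ _ L0 L1) L2) L3).
  match type of L with is_series ?u ?l =>
    assert (E : l = exp y * (A + B * ((y + 1) / y) + C * ((y + 1) / y ^ 2))
                    + K * ((exp y - 1) / y)) end.
  { unfold plus, scal; cbn; unfold mult; cbn; field; lra. }
  rewrite <- E; refine (is_series_ext _ _ _ _ L).
  intros n; unfold plus, scal; cbn -[INR fact pow]; unfold mult; cbn -[INR fact pow].
  unfold egf_term.
  assert (Ep : INR n * INR (Init.Nat.pred n) = INR n * (INR n - 1)).
  { destruct n as [|n]; [cbn; ring|]. cbn [pred]; rewrite S_INR; ring. }
  pose proof (INR_S_pos n); pose proof (INR_fact_pos n).
  replace (INR n * (INR (Init.Nat.pred n) * 1)) with (INR n * (INR n - 1)) by (rewrite <- Ep; ring).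
  rewrite S_INR in *; field; lra.
Qed.

(** Two comparisons are made termwise: [c n] with [kappa (n+1)^s], then [(n+1)^s] with [y^s]. In the
    second, the ratio [w = (n+1)/y] satisfies [|w^s - 1| <= |w - 1|], so the variance of the Poisson
    law controls the sum. *)
Lemma poisson_limit_01 (s : R) : 0 <= s <= 1 -> poisson_limit s.
Proof.
  intros Hs c kappa Hc Hk; apply is_lim_spec; intros eps; cbn.
  assert (Hka := Rabs_pos kappa).
  assert (He := cond_pos eps).
  (* Chosen so that [e (Rabs kappa + 3) = eps / 2]: the final bound contains [Rabs kappa * e], [e]
     and [e (1 + 1/y)], the last below [2 e] because [y > 1]. *)
  set (e := eps / (2 * (Rabs kappa + 3))).
  assert (He0 : 0 < e) by (apply Rdiv_lt_0_compat; lra).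
  apply is_lim_seq_spec in Hk; destruct (Hk (mkposreal e He0)) as [N HN]; cbn [pos] in HN.
  set (d := fun n => Rpower (INR (S n)) s).
  assert (Hd : forall n, 0 < d n) by (intros n; apply Rpower_pos).
  (* [K] absorbs the finitely many indices below [N], giving for every [n] an error
     [e * d n + K / INR (S n)]. The weight [1/(n+1)] has Poisson mean at most [1/y]; a constant
     error would not disappear when [s = 0]. *)
  destruct (eventually_bounded
              (fun n => (Rabs (c n - kappa * d n) - e * d n) * INR (S n)) N) as [K [HK0 HK]].
  { intros n Hn; specialize (HN n Hn); change (Rpower (INR (S n)) s) with (d n) in HN; specialize (Hd n).
    assert (Rabs (c n - kappa * d n) <= e * d n).
    { replace (c n - kappa * d n) with ((c n / d n - kappa) * d n) by (field; lra).
      rewrite Rabs_mult, (Rabs_pos_eq (d n)) by lra.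
      apply Rmult_le_compat_r; lra. }
    pose proof (INR_S_pos n); cbv beta; nra. }
  (* Beyond [T], the terms decaying like [1/y] contribute less than [eps / 2]. *)
  set (T := (2 * Rabs kappa / e + K) * 2 / eps).
  exists (Rmax 1 T); intros y Hy.
  assert (Hy1 : 1 < y) by (eapply Rle_lt_trans; [apply Rmax_l|exact Hy]).
  assert (HyT : T < y) by (eapply Rle_lt_trans; [apply Rmax_r|exact Hy]).
  set (q := fun n => (Rabs kappa * e + e) + e * (INR (S n) / y)
                     + (Rabs kappa / e) * (INR (S n) / y - 1) ^ 2 + K / INR (S n)).
  assert (HYs : 1 <= Rpower y s) by (rewrite <- (Rpower_O y) by lra; apply Rle_Rpower; lra).
  assert (Hpt : forall n, Rabs (c n - kappa * Rpower y s) <= Rpower y s * q n).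
  { intros n; pose proof (INR_S_pos n) as HnS.
    set (w := INR (S n) / y).
    assert (Hw : 0 < w) by (apply Rdiv_lt_0_compat; lra).
    assert (Ed : d n = Rpower w s * Rpower y s).
    { unfold d, w; rewrite Rpower_mult_distr by (try apply Rdiv_lt_0_compat; lra).
      f_equal; field; lra. }
    assert (Hb := Rpower_bernoulli s w Hw Hs).
    assert (Hb1 := Rpower_dist_1 s w Hw Hs).
    assert (HKn : Rabs (c n - kappa * d n) <= e * d n + K / INR (S n)).
    { specialize (HK n); cbn beta in HK.
      apply Rmult_le_reg_r with (INR (S n)); [exact HnS|].
      replace ((e * d n + K / INR (S n)) * INR (S n)) with (e * d n * INR (S n) + K) by (field; lra).
      lra. }
    (* The absolute deviation is traded for a squared one, which the second moment can sum:
       [r e <= e^2 + r^2]. *)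
    assert (Hsq : Rabs (w - 1) <= e + (w - 1) ^ 2 / e).
    { rewrite <- (pow2_abs (w - 1)); set (r := Rabs (w - 1)).
      apply Rmult_le_reg_r with e; [exact He0|].
      replace ((e + r ^ 2 / e) * e) with (e * e + r * r) by (field; lra).
      nra. }
    assert (Htri : Rabs (c n - kappa * Rpower y s)
                   <= Rabs (c n - kappa * d n) + Rabs kappa * (Rabs (Rpower w s - 1) * Rpower y s)).
    { replace (c n - kappa * Rpower y s)
        with ((c n - kappa * d n) + kappa * ((Rpower w s - 1) * Rpower y s)) by (rewrite Ed; ring).
      eapply Rle_trans; [apply Rabs_triang|].
      rewrite (Rabs_mult kappa), (Rabs_mult _ (Rpower y s)), (Rabs_pos_eq (Rpower y s)) by lra.
      apply Rle_refl. }
    assert (HKd : K / INR (S n) <= Rpower y s * (K / INR (S n))).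
    { assert (0 <= K / INR (S n)) by (apply Rdiv_le_0_compat; lra). nra. }
    assert (Rabs kappa * (Rabs (Rpower w s - 1) * Rpower y s)
            <= Rabs kappa * ((e + (w - 1) ^ 2 / e) * Rpower y s)).
    { apply Rmult_le_compat_l; [lra|]. apply Rmult_le_compat_r; lra. }
    assert (e * d n <= e * (1 + w) * Rpower y s).
    { rewrite Ed, <- Rmult_assoc; apply Rmult_le_compat_r; [lra|].
      apply Rmult_le_compat_l; nra. }
    unfold q; fold w.
    replace (Rpower y s * (Rabs kappa * e + e + e * w + Rabs kappa / e * (w - 1) ^ 2 + K / INR (S n)))
      with (Rabs kappa * ((e + (w - 1) ^ 2 / e) * Rpower y s) + e * (1 + w) * Rpower y s
            + Rpower y s * (K / INR (S n))) by (field; lra).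
    lra. }
  assert (Hq := is_series_poisson_bound (Rabs kappa * e + e) e (Rabs kappa / e) K y ltac:(lra)).
  fold q in Hq.
  assert (Hcs := Series_correct _ (Hc y ltac:(lra))).
  assert (Hdiff := is_series_minus _ _ _ _ Hcs
                     (is_series_scal (kappa * Rpower y s) _ _ (is_series_exp y))).
  assert (Hbound := is_series_Rabs_le _ _ _ _ Hdiff (is_series_scal (Rpower y s) _ _ Hq)).
  assert (Hle : Rabs (Series (egf_term c y) - kappa * Rpower y s * exp y)
    <= Rpower y s * (exp y * (Rabs kappa * e + e + e * ((y + 1) / y)
                              + Rabs kappa / e * ((y + 1) / y ^ 2))
                     + K * ((exp y - 1) / y))).
  { apply Hbound; intros n.
    unfold minus, plus, opp, scal; cbn -[INR fact pow]; unfold mult; cbn -[INR fact pow].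
    unfold egf_term.
    replace (c n * y ^ n / INR (fact n) + - (kappa * Rpower y s * (1 * y ^ n / INR (fact n))))
      with ((c n - kappa * Rpower y s) * (y ^ n / INR (fact n)))
      by (field; pose proof (INR_fact_pos n); lra).
    assert (0 <= y ^ n / INR (fact n)).
    { apply Rdiv_le_0_compat; [apply pow_le; lra|apply INR_fact_pos]. }
    rewrite Rabs_mult, (Rabs_pos_eq (y ^ n / INR (fact n))) by assumption.
    replace (Rpower y s * (q n * y ^ n / INR (fact n)))
      with (Rpower y s * q n * (y ^ n / INR (fact n)))
      by (field; pose proof (INR_fact_pos n); lra).
    apply Rmult_le_compat_r; [assumption|apply Hpt]. }
  clear Hbound Hdiff Hcs Hq Hpt.
  rewrite Rpower_Ropp, exp_Ropp.
  assert (Hey := exp_pos y).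
  replace (Series (egf_term c y) * / exp y * / Rpower y s - kappa)
    with ((Series (egf_term c y) - kappa * Rpower y s * exp y) * / (exp y * Rpower y s))
    by (field; lra).
  rewrite Rabs_mult, (Rabs_pos_eq (/ _)) by (apply Rlt_le, Rinv_0_lt_compat; nra).
  apply Rle_lt_trans with
    ((Rpower y s * (exp y * (Rabs kappa * e + e + e * ((y + 1) / y)
                              + Rabs kappa / e * ((y + 1) / y ^ 2))
                     + K * (exp y / y))) * / (exp y * Rpower y s)).
  { apply Rmult_le_compat_r; [apply Rlt_le, Rinv_0_lt_compat; nra|].
    eapply Rle_trans; [exact Hle|].
    apply Rmult_le_compat_l; [lra|]. apply Rplus_le_compat_l, Rmult_le_compat_l; [lra|].
    apply Rmult_le_compat_r; [apply Rlt_le, Rinv_0_lt_compat|]; lra. }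
  replace ((Rpower y s * (exp y * (Rabs kappa * e + e + e * ((y + 1) / y)
                              + Rabs kappa / e * ((y + 1) / y ^ 2))
                     + K * (exp y / y))) * / (exp y * Rpower y s))
    with (Rabs kappa * e + e + e * ((y + 1) / y) + Rabs kappa / e * ((y + 1) / y ^ 2) + K / y)
    by (field; lra).
  assert (Hiy : 0 < / y < 1).
  { split; [apply Rinv_0_lt_compat; lra|rewrite <- Rinv_1; apply Rinv_lt_contravar; lra]. }
  assert (Hke : 0 <= Rabs kappa / e) by (apply Rdiv_le_0_compat; lra).
  replace ((y + 1) / y) with (1 + / y) by (field; lra).
  replace ((y + 1) / y ^ 2) with (/ y + / y * / y) by (field; lra).
  assert (H1 : (2 * Rabs kappa / e + K) * / y < eps / 2).
  { apply Rmult_lt_reg_r with (y * 2 / eps).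
    - apply Rdiv_lt_0_compat; lra.
    - replace ((2 * Rabs kappa / e + K) * / y * (y * 2 / eps)) with T
        by (unfold T; field; repeat split; lra).
      replace (eps / 2 * (y * 2 / eps)) with y by (field; lra). exact HyT. }
  assert (H2 : e * (Rabs kappa + 3) = eps / 2) by (unfold e; field; lra).
  assert (H3 : Rabs kappa / e * (/ y + / y * / y) <= 2 * Rabs kappa / e * / y).
  { replace (2 * Rabs kappa / e * / y) with (Rabs kappa / e * (2 * / y)) by (field; lra).
    apply Rmult_le_compat_l; [exact Hke|nra]. }
  unfold Rdiv in *; nra.
Qed.

Lemma is_lim_seq_Rpower_1 (u : nat -> R) (p : R) :
  is_lim_seq u 1 -> is_lim_seq (fun n => Rpower (u n) p) 1.
Proof.
  intros Hu.
  replace (Finite 1) with (Finite (Rpower 1 p))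
    by (unfold Rpower; now rewrite ln_1, Rmult_0_r, exp_0).
  apply (is_lim_seq_continuous (fun x => Rpower x p)); [|exact Hu].
  apply derivable_continuous_pt; exists (p * Rpower 1 (p - 1)).
  apply derivable_pt_lim_power; lra.
Qed.

Lemma Rpower_div (x y p : R) : 0 < x -> 0 < y -> Rpower (x / y) p = Rpower x p / Rpower y p.
Proof.
  intros Hx Hy.
  replace (Rpower x p) with (Rpower (x / y) p * Rpower y p).
  - field; apply Rgt_not_eq, Rpower_pos.
  - rewrite Rpower_mult_distr by (try apply Rdiv_lt_0_compat; lra); f_equal; field; lra.
Qed.

(** The sequence [n c(n-1)] has growth exponent [s + 1] with the same constant, and its sum is [y]
    times that of [c]. *)
Lemma poisson_limit_pred (s : R) : poisson_limit (s + 1) -> poisson_limit s.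
Proof.
  intros H c kappa Hc Hk.
  assert (Hc' : forall y, 0 < y ->
            is_series (egf_term (fun n => INR n * c (pred n)) y) (y * Series (egf_term c y))).
  { intros y Hy; apply is_series_egf_mult, Series_correct, Hc, Hy. }
  apply is_lim_ext_loc with
    (fun y => Series (egf_term (fun n => INR n * c (pred n)) y) * exp (- y) * Rpower y (- (s + 1))).
  { exists 0; intros y Hy; rewrite (is_series_unique _ _ (Hc' y Hy)).
    replace (- s) with (1 + - (s + 1)) by ring.
    rewrite Rpower_plus, Rpower_1 by exact Hy; ring. }
  apply H; [intros y Hy; eexists; apply Hc', Hy|].
  apply is_lim_seq_incr_1; cbn [pred].
  apply is_lim_seq_ext with
    (fun n => c n / Rpower (INR (S n)) s * Rpower ((1 + INR n) / (2 + INR n)) (s + 1)).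
  { intros n.
    replace (1 + INR n) with (INR (S n)) by (rewrite S_INR; ring).
    replace (2 + INR n) with (INR (S (S n))) by (rewrite !S_INR; ring).
    assert (H1 := INR_S_pos n); assert (H2 := INR_S_pos (S n)).
    rewrite Rpower_div by assumption.
    rewrite (Rpower_plus s 1 (INR (S n))), Rpower_1 by assumption.
    field; split; apply Rgt_not_eq, Rpower_pos. }
  replace kappa with (kappa * 1) by ring.
  apply is_lim_seq_mult'; [exact Hk|].
  apply is_lim_seq_Rpower_1, is_lim_seq_ratio.
Qed.

(** Passing to [c(n+1)/(n+1)] lowers the exponent from [s + 1] to [s]. The detached term [c 0] is
    negligible because of the factor [exp (- y)]. *)
Lemma poisson_limit_succ (s : R) : poisson_limit s -> poisson_limit (s + 1).
Proof.
  intros H c kappa Hc Hk.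
  assert (Hc' : forall y, 0 < y ->
            is_series (egf_term (fun n => c (S n) / INR (S n)) y)
              ((Series (egf_term c y) - c 0%nat) / y)).
  { intros y Hy; apply is_series_egf_div; [lra|apply Series_correct, Hc, Hy]. }
  apply is_lim_ext_loc with
    (fun y => c 0%nat * (exp (- y) * Rpower y (- (s + 1)))
              + Series (egf_term (fun n => c (S n) / INR (S n)) y) * exp (- y) * Rpower y (- s)).
  { exists 0; intros y Hy; rewrite (is_series_unique _ _ (Hc' y Hy)).
    replace (- s) with (1 + - (s + 1)) by ring.
    rewrite Rpower_plus, Rpower_1 by exact Hy; field; lra. }
  replace (Finite kappa) with (Finite (c 0%nat * 0 + kappa)) by (f_equal; ring).
  apply is_lim_plus'.
  { apply is_lim_scal_l with (a := c 0%nat) (l := 0), is_lim_exp_neg_Rpower. }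
  apply H; [intros y Hy; eexists; apply Hc', Hy|].
  apply is_lim_seq_ext with
    (fun n => c (S n) / Rpower (INR (S (S n))) (s + 1) * Rpower ((2 + INR n) / (1 + INR n)) (s + 1)).
  { intros n.
    replace (1 + INR n) with (INR (S n)) by (rewrite S_INR; ring).
    replace (2 + INR n) with (INR (S (S n))) by (rewrite !S_INR; ring).
    assert (H1 := INR_S_pos n); assert (H2 := INR_S_pos (S n)).
    rewrite Rpower_div by assumption.
    rewrite (Rpower_plus s 1 (INR (S n))), Rpower_1 by assumption.
    assert (Hp := Rpower_pos (INR (S n)) s); assert (Hq := Rpower_pos (INR (S (S n))) (s + 1)).
    field; repeat split; lra. }
  replace kappa with (kappa * 1) by ring.
  apply is_lim_seq_mult'; [now apply is_lim_seq_incr_1 in Hk|].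
  apply is_lim_seq_Rpower_1, is_lim_seq_ratio.
Qed.

Lemma poisson_limit_all (s : R) : poisson_limit s.
Proof.
  replace s with (frac_part s + IZR (Int_part s)) by (unfold frac_part; ring).
  induction (Int_part s) as [|m IH|m IH] using Z.peano_ind.
  - rewrite Rplus_0_r; apply poisson_limit_01; destruct (base_fp s); lra.
  - rewrite succ_IZR, <- Rplus_assoc; now apply poisson_limit_succ.
  - apply poisson_limit_pred.
    now replace (frac_part s + IZR (Z.pred m) + 1) with (frac_part s + IZR m)
      by (unfold Z.pred; rewrite plus_IZR; ring).
Qed.

(** * Kummer's function *)

Definition kummer_coef (a b : R) (n : nat) : R := rising a n / rising b n.

Lemma kummer_coef_S (a b : R) (n : nat) :
  nonint b -> kummer_coef a b (S n) = kummer_coef a b n * ((a + INR n) / (b + INR n)).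
Proof.
  intros Hb; unfold kummer_coef; cbn [rising]; field; split;
    [now apply nonint_plus_INR_neq0|now apply rising_neq0].
Qed.

Lemma kummer_coef_S_l (a b : R) (n : nat) :
  nonint b -> kummer_coef a b (S n) = a / b * kummer_coef (a + 1) (b + 1) n.
Proof.
  intros Hb; unfold kummer_coef; rewrite !rising_S_l; field; split;
    [now apply rising_neq0, nonint_succ|exact (Hb 0%Z)].
Qed.

Lemma kummer_coef_neq0 (a b : R) (n : nat) : nonint a -> nonint b -> kummer_coef a b n <> 0.
Proof.
  intros Ha Hb; unfold kummer_coef, Rdiv; apply Rmult_integral_contrapositive; split;
    [|apply Rinv_neq_0_compat]; now apply rising_neq0.
Qed.

Definition kummer_ps (a b : R) (n : nat) : R := kummer_coef a b n / INR (fact n).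

(** The ratio test; with [a] and [b] non-integers no coefficient vanishes and the quotients make
    sense. *)
Lemma CV_radius_kummer_ps (a b : R) :
  nonint a -> nonint b -> CV_radius (kummer_ps a b) = p_infty.
Proof.
  intros Ha Hb; apply CV_radius_infinite_DAlembert.
  - intros n; unfold kummer_ps, Rdiv; apply Rmult_integral_contrapositive; split;
      [now apply kummer_coef_neq0|apply Rinv_neq_0_compat, INR_fact_neq_0].
  - rewrite <- Rabs_R0.
    apply (is_lim_seq_abs _ (Finite 0)).
    apply is_lim_seq_ext with (fun n => (a + INR n) / (b + INR n) * / INR (S n)).
    { intros n; unfold kummer_ps; rewrite kummer_coef_S, fact_S_INR by exact Hb.
      assert (H1 := INR_S_pos n); assert (H2 := INR_fact_pos n).
      assert (H3 := kummer_coef_neq0 a b n Ha Hb).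
      assert (H4 := nonint_plus_INR_neq0 b n Hb).
      field; repeat split; try assumption; lra. }
    replace (Finite 0) with (Finite (1 * 0)) by (f_equal; ring).
    apply is_lim_seq_mult'; [apply is_lim_seq_ratio|].
    apply (is_lim_seq_incr_1 (fun n => / INR n)).
    replace (Finite 0) with (Rbar_inv p_infty) by reflexivity.
    apply is_lim_seq_inv; [apply is_lim_seq_INR|discriminate].
Qed.

Lemma KummerM_PSeries (a b z : R) : KummerM a b z = PSeries (kummer_ps a b) z.
Proof.
  apply Series_ext; intros n; unfold kummer_ps, kummer_coef, Rdiv; ring.
Qed.

Lemma kummer_inside (a b z : R) :
  nonint a -> nonint b -> Rbar_lt (Rabs z) (CV_radius (kummer_ps a b)).
Proof. intros Ha Hb; now rewrite CV_radius_kummer_ps. Qed.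

Lemma ex_series_Rabs_KummerM (a b z : R) :
  nonint a -> nonint b -> ex_series (fun n => Rabs (egf_term (kummer_coef a b) z n)).
Proof.
  intros Ha Hb.
  apply ex_series_ext with (fun n => Rabs (kummer_ps a b n * z ^ n)).
  - intros n; f_equal; unfold kummer_ps, egf_term, Rdiv; ring.
  - now apply CV_disk_inside, kummer_inside.
Qed.

Lemma is_series_KummerM (a b z : R) :
  nonint a -> nonint b -> is_series (egf_term (kummer_coef a b) z) (KummerM a b z).
Proof.
  intros Ha Hb; apply Series_correct, ex_series_Rabs; now apply ex_series_Rabs_KummerM.
Qed.

Definition KummerM_d1 (a b z : R) : R := a / b * KummerM (a + 1) (b + 1) z.
Definition KummerM_d2 (a b z : R) : R := a / b * KummerM_d1 (a + 1) (b + 1) z.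

Lemma is_derive_KummerM (a b z : R) :
  nonint a -> nonint b -> is_derive (KummerM a b) z (KummerM_d1 a b z).
Proof.
  intros Ha Hb.
  apply is_derive_ext with (PSeries (kummer_ps a b));
    [intros t; symmetry; apply KummerM_PSeries|].
  replace (KummerM_d1 a b z) with (PSeries (PS_derive (kummer_ps a b)) z);
    [now apply is_derive_PSeries, kummer_inside|].
  unfold KummerM_d1; rewrite KummerM_PSeries, <- PSeries_scal.
  apply PSeries_ext; intros n.
  unfold PS_derive, PS_scal, kummer_ps, scal; cbn -[INR fact]; unfold mult; cbn -[INR fact].
  rewrite kummer_coef_S_l, fact_S_INR by exact Hb.
  pose proof (INR_S_pos n); pose proof (INR_fact_pos n); pose proof (Hb 0%Z).
  field; repeat split; lra.
Qed.

Lemma is_derive_KummerM_d1 (a b z : R) :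
  nonint a -> nonint b -> is_derive (KummerM_d1 a b) z (KummerM_d2 a b z).
Proof.
  intros Ha Hb; unfold KummerM_d2.
  apply (is_derive_scal (KummerM (a + 1) (b + 1)) z (a / b)).
  apply is_derive_KummerM; now apply nonint_succ.
Qed.

(** Multiplication by [z] is the index shift of [is_series_egf_mult], so all four terms become
    series in the same powers [z^n / n!], and the equation holds coefficient by coefficient. *)
Lemma KummerM_ode (a b z : R) :
  nonint a -> nonint b ->
  z * KummerM_d2 a b z + (b - z) * KummerM_d1 a b z - a * KummerM a b z = 0.
Proof.
  intros Ha Hb.
  assert (Ha1 := nonint_succ a Ha); assert (Hb1 := nonint_succ b Hb).
  assert (H0 := is_series_KummerM a b z Ha Hb).
  assert (H1 := is_series_KummerM _ _ z Ha1 Hb1).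
  assert (H2 := is_series_KummerM _ _ z (nonint_succ _ Ha1) (nonint_succ _ Hb1)).
  assert (H1' := is_series_egf_mult _ _ _ H1).
  assert (H2' := is_series_egf_mult _ _ _ H2).
  assert (L := is_series_plus _ _ _ _ (is_series_plus _ _ _ _ (is_series_plus _ _ _ _
     (is_series_scal (a / b * ((a + 1) / (b + 1))) _ _ H2')
     (is_series_scal a _ _ H1))
     (is_series_scal (- (a / b)) _ _ H1'))
     (is_series_scal (- a) _ _ H0)).
  assert (Hb0 : b <> 0) by exact (Hb 0%Z).
  assert (Hb10 : b + 1 <> 0) by exact (Hb1 0%Z).
  assert (E := is_series_unique _ _ L).
  erewrite Series_ext in E.
  2:{ intros n.
      (* The zero term is written as a product so that [Series_scal_l] evaluates the sum
         afterwards. *)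
      instantiate (1 := fun _ => 0 * 0); rewrite Rmult_0_l.
      unfold plus, scal; cbn -[INR fact pow]; unfold mult; cbn -[INR fact pow].
      unfold egf_term.
      destruct n as [|n].
      - unfold kummer_coef; cbn; field; repeat split; assumption.
      - cbn [pred].
        assert (E0 := kummer_coef_S_l a b n Hb).
        assert (E1 := kummer_coef_S a b n Hb).
        assert (E2 := kummer_coef_S_l (a + 1) (b + 1) n Hb1).
        assert (E3 := kummer_coef_S (a + 1) (b + 1) n Hb1).
        set (k1 := kummer_coef (a + 1) (b + 1) n) in *.
        set (k2 := kummer_coef (a + 1 + 1) (b + 1 + 1) n) in *.
        rewrite E3 in E2 |- *; rewrite E0.
        assert (Hn1 := nonint_plus_INR_neq0 (b + 1) n Hb1).
        assert (Hf := INR_fact_neq_0 (S n)).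
        replace (a / b * ((a + 1) / (b + 1)) * (INR (S n) * k2 * z ^ S n / INR (fact (S n))))
          with (a / b * (INR (S n) * ((a + 1) / (b + 1) * k2) * z ^ S n / INR (fact (S n))))
          by (field; repeat split; assumption).
        rewrite <- E2, S_INR; field; repeat split; assumption. }
  rewrite Series_scal_l, Rmult_0_l in E.
  unfold plus, scal in E; cbn -[INR fact] in E; unfold mult in E; cbn -[INR fact] in E.
  rewrite E; unfold KummerM_d2, KummerM_d1; field; split; assumption.
Qed.

(** * Kummer's transformation and growth at infinity *)

(** The Chu-Vandermonde identity. Pascal's rule writes the sum of order [n + 1] at [(c, b)] as the
    sum of order [n] at [(c, b)] minus [c/b] times the one at [(c+1, b+1)], hence an induction
    general in both parameters. *)
Lemma sum_binomial_kummer_coef (n : nat) : forall c b : R,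
  nonint b ->
  sum_f_R0 (fun k => (-1) ^ k * Binomial.C n k * kummer_coef c b k) n = kummer_coef (b - c) b n.
Proof.
  induction n as [|n IH]; intros c b Hb.
  { cbn; unfold kummer_coef, Binomial.C; cbn; field. }
  assert (Hb1 := nonint_succ b Hb).
  assert (Hb0 : b <> 0) by exact (Hb 0%Z).
  assert (Hbn := nonint_plus_INR_neq0 b n Hb).
  assert (Step : sum_f_R0 (fun k => (-1) ^ k * Binomial.C (S n) k * kummer_coef c b k) (S n)
    = sum_f_R0 (fun k => (-1) ^ k * Binomial.C n k * kummer_coef c b k) n
      - c / b * sum_f_R0 (fun k => (-1) ^ k * Binomial.C n k * kummer_coef (c + 1) (b + 1) k) n).
  { rewrite decomp_sum by lia; cbn [pred].
    rewrite scal_sum.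
    rewrite (sum_eq (fun i => (-1) ^ i * Binomial.C n i * kummer_coef (c + 1) (b + 1) i * (c / b))
               (fun i => (-1) ^ i * Binomial.C n i * kummer_coef c b (S i)))
      by (intros i _; rewrite kummer_coef_S_l by exact Hb; ring).
    assert (C0 : forall m, Binomial.C m 0 = 1).
    { intros m; unfold Binomial.C; rewrite Nat.sub_0_r; cbn [fact INR]; field.
      apply INR_fact_neq_0. }
    assert (Cn : forall m, Binomial.C m m = 1).
    { intros m; unfold Binomial.C; rewrite Nat.sub_diag; cbn [fact INR]; field.
      apply INR_fact_neq_0. }
    destruct n as [|n].
    - cbn [sum_f_R0]; rewrite !C0, Cn; cbn; ring.
    - rewrite (tech5 _ n), Cn.
      rewrite (tech5 (fun i => (-1) ^ i * Binomial.C (S n) i * kummer_coef c b (S i)) n), Cn.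
      rewrite (decomp_sum (fun k => (-1) ^ k * Binomial.C (S n) k * kummer_coef c b k) (S n)) by lia.
      cbn [pred]; rewrite !C0.
      rewrite (sum_eq (fun i => (-1) ^ S i * Binomial.C (S (S n)) (S i) * kummer_coef c b (S i))
        (fun i => (-1) ^ S i * Binomial.C (S n) (S i) * kummer_coef c b (S i)
                  - (-1) ^ i * Binomial.C (S n) i * kummer_coef c b (S i))).
      + rewrite minus_sum; cbn [pow]; ring.
      + intros i Hi; rewrite <- (pascal (S n) i) by lia; cbn [pow]; ring. }
  rewrite Step, IH, IH by assumption.
  replace (b + 1 - (c + 1)) with (b - c) by ring.
  rewrite kummer_coef_S by exact Hb.
  unfold kummer_coef.
  assert (E : b * rising (b + 1) n = rising b n * (b + INR n)) by (rewrite <- rising_S_l; reflexivity).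
  assert (H1 := rising_neq0 b n Hb).
  replace (rising (b + 1) n) with (rising b n * (b + INR n) / b) by (rewrite <- E; field; exact Hb0).
  field; repeat split; assumption.
Qed.

(** The Cauchy product of the series for [M(b-a,b,y)] and [exp (- y)]; its coefficients are the
    Chu-Vandermonde sums with [c = b - a]. *)
Lemma KummerM_transform (a b y : R) :
  nonint (b - a) -> nonint b -> KummerM a b (- y) = KummerM (b - a) b y * exp (- y).
Proof.
  intros Hc Hb.
  assert (L := is_series_mult _ _ _ _ (is_series_KummerM (b - a) b y Hc Hb) (is_series_exp (- y))
                 (ex_series_Rabs_KummerM _ _ _ Hc Hb)).
  assert (He : ex_series (fun n => Rabs (egf_term (fun _ => 1) (- y) n))).
  { apply ex_series_ext with (egf_term (fun _ => 1) (Rabs y)); [|eexists; apply is_series_exp].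
    intros n; unfold egf_term, Rdiv.
    rewrite Rabs_mult, (Rabs_pos_eq (/ _)) by (apply Rlt_le, Rinv_0_lt_compat, INR_fact_pos).
    rewrite Rabs_mult, Rabs_R1, <- RPow_abs, Rabs_Ropp; reflexivity. }
  specialize (L He); rewrite <- (is_series_unique _ _ L).
  apply Series_ext; intros n.
  transitivity ((- y) ^ n / INR (fact n) * kummer_coef a b n);
    [unfold kummer_coef, Rdiv; ring|].
  replace (kummer_coef a b n) with (kummer_coef (b - (b - a)) b n) by (f_equal; ring).
  rewrite <- sum_binomial_kummer_coef, scal_sum by exact Hb.
  apply sum_eq; intros k Hk; unfold egf_term, Binomial.C.
  replace ((- y) ^ n) with ((- y) ^ k * (- y) ^ (n - k)) by (rewrite <- pow_add; f_equal; lia).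
  replace ((- y) ^ k) with ((-1) ^ k * y ^ k) by (rewrite <- Rpow_mult_distr; f_equal; ring).
  assert (E : (-1) ^ k * (-1) ^ k = 1).
  { rewrite <- Rpow_mult_distr; replace (-1 * -1) with 1 by ring; apply pow1. }
  transitivity (((-1) ^ k * (-1) ^ k) * (kummer_coef (b - a) b k * y ^ k / INR (fact k)
    * (1 * (- y) ^ (n - k) / INR (fact (n - k)))));
    [field; repeat split; apply INR_fact_neq_0|rewrite E; ring].
Qed.

Lemma is_lim_KummerM (a b : R) :
  nonint a -> nonint b ->
  is_lim (fun y => KummerM a b y * exp (- y) * Rpower y (b - a)) p_infty (Gamma b / Gamma a).
Proof.
  intros Ha Hb.
  replace (b - a) with (- (a - b)) by ring.
  apply (poisson_limit_all (a - b) (kummer_coef a b)).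
  { intros y _; eexists; now apply is_series_KummerM. }
  (* The quotient [gauss b n / gauss a n] involves rising factorials of length [S n], so the
     coefficients are read at [S n]. The base is then [n + 2] instead of [n], which costs a factor
     tending to 1. *)
  apply is_lim_seq_incr_1.
  apply is_lim_seq_ext_loc with
    (fun n => gauss b n / gauss a n * Rpower ((0 + INR n) / (2 + INR n)) (a - b)).
  { exists 1%nat; intros n Hn.
    assert (Hn0 : 0 < INR n) by (apply lt_0_INR; lia).
    replace (2 + INR n) with (INR (S (S n))) by (rewrite !S_INR; ring).
    assert (H2 := INR_S_pos (S n)).
    rewrite Rplus_0_l, Rpower_div by assumption.
    assert (Ea := rising_neq0 a (S n) Ha); assert (Eb := rising_neq0 b (S n) Hb).
    unfold gauss, kummer_coef, Rminus; rewrite (Rpower_plus a (- b) (INR n)), (Rpower_Ropp (INR n)).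
    assert (H3 := Rpower_pos (INR n) a); assert (H4 := Rpower_pos (INR n) b).
    assert (H5 := Rpower_pos (INR (S (S n))) (a + - b)).
    assert (H6 := INR_fact_pos n).
    field; repeat split; try assumption; lra. }
  replace (Gamma b / Gamma a) with (Gamma b / Gamma a * 1) by ring.
  apply is_lim_seq_mult'; [|apply is_lim_seq_Rpower_1, is_lim_seq_ratio].
  apply is_lim_seq_div'; [now apply is_lim_seq_Gamma..|now apply Gamma_neq0].
Qed.

(** * Asymptotics of Tricomi's function *)

Lemma is_derive_Rpower (p x : R) :
  0 < x -> is_derive (fun t => Rpower t p) x (p * Rpower x (p - 1)).
Proof. intros Hx; now apply is_derive_Reals, derivable_pt_lim_power. Qed.

Lemma Derive_KummerM (a b z : R) :
  nonint a -> nonint b -> Derive (fun x : R => KummerM a b x) z = KummerM_d1 a b z.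
Proof. intros Ha Hb; now apply is_derive_unique, is_derive_KummerM. Qed.

Lemma Derive_KummerM_d1 (a b z : R) :
  nonint a -> nonint b -> Derive (fun x : R => KummerM_d1 a b x) z = KummerM_d2 a b z.
Proof. intros Ha Hb; now apply is_derive_unique, is_derive_KummerM_d1. Qed.

(** The left side is [y^b] times the Wronskian of [M(a,b,y)] and [y^(1-b) M(a+1-b,2-b,y)]. This
    scaling removes the fractional powers, so that after multiplication by [exp (- y)] the quantity
    is differentiable on all of [[0, y]]. Both Kummer equations make its derivative zero, and its
    value at 0 is [1 - b]. *)
Lemma kummer_wronskian (a b y : R) :
  nonint a -> nonint b -> nonint (a + 1 - b) -> 0 < y ->
  KummerM a b y * ((1 - b) * KummerM (a + 1 - b) (2 - b) y + y * KummerM_d1 (a + 1 - b) (2 - b) y)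
  - y * KummerM_d1 a b y * KummerM (a + 1 - b) (2 - b) y = (1 - b) * exp y.
Proof.
  intros Ha Hb Hab Hy.
  assert (Hb2 : nonint (2 - b)).
  { replace (2 - b) with (- b + 2) by ring; apply (nonint_plus_IZR (- b) 2), nonint_opp, Hb. }
  set (w := fun y =>
    (KummerM a b y * ((1 - b) * KummerM (a + 1 - b) (2 - b) y + y * KummerM_d1 (a + 1 - b) (2 - b) y)
     - y * KummerM_d1 a b y * KummerM (a + 1 - b) (2 - b) y) * exp (- y)).
  assert (Hw : w 0 = w y).
  { apply eq_is_derive; [|exact Hy].
    intros t _; unfold w.
    assert (H1 := is_derive_KummerM a b t Ha Hb).
    assert (H2 := is_derive_KummerM_d1 a b t Ha Hb).
    assert (H3 := is_derive_KummerM _ _ t Hab Hb2).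
    assert (H4 := is_derive_KummerM_d1 _ _ t Hab Hb2).
    assert (O1 := KummerM_ode a b t Ha Hb).
    assert (O2 := KummerM_ode _ _ t Hab Hb2).
    auto_derive; [repeat split; eexists; eassumption|].
    rewrite !Derive_KummerM, !Derive_KummerM_d1 by assumption.
    change (zero : R) with 0.
    set (m1 := KummerM a b t) in *; set (d1 := KummerM_d1 a b t) in *.
    set (e1 := KummerM_d2 a b t) in *.
    set (m2 := KummerM (a + 1 - b) (2 - b) t) in *.
    set (d2 := KummerM_d1 (a + 1 - b) (2 - b) t) in *.
    set (e2 := KummerM_d2 (a + 1 - b) (2 - b) t) in *.
    match goal with |- ?lhs = _ => replace lhs with
      (exp (- t) * (m1 * (t * e2 + (2 - b - t) * d2 - (a + 1 - b) * m2)
                    - m2 * (t * e1 + (b - t) * d1 - a * m1))) by ring end.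
    rewrite O1, O2; ring. }
  assert (H0 : forall a' b', KummerM a' b' 0 = 1).
  { intros a' b'; rewrite KummerM_PSeries, PSeries_0; unfold kummer_ps, kummer_coef; cbn; field. }
  unfold w at 1 in Hw; rewrite !H0, Ropp_0, exp_0 in Hw.
  match goal with |- ?l = _ => replace l with (w y * exp y) end.
  - rewrite <- Hw; ring.
  - unfold w; rewrite Rmult_assoc, <- exp_plus; replace (- y + y) with 0 by ring.
    rewrite exp_0; ring.
Qed.

Lemma is_lim_neq0 (f : R -> R) (l : R) :
  is_lim f p_infty l -> l <> 0 -> Rbar_locally p_infty (fun y => f y <> 0).
Proof.
  intros H Hl; apply is_lim_spec in H.
  assert (Hp : 0 < Rabs l) by now apply Rabs_pos_lt.
  destruct (H (mkposreal _ Hp)) as [M HM]; exists M; intros y Hy E.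
  specialize (HM y Hy); rewrite E in HM; cbn in HM.
  unfold Rminus in HM; rewrite Rplus_0_l, Rabs_Ropp in HM; lra.
Qed.

Lemma is_lim_div_finite (f g : R -> R) (x : Rbar) (lf lg : R) :
  is_lim f x lf -> is_lim g x lg -> lg <> 0 -> is_lim (fun y => f y / g y) x (lf / lg).
Proof.
  intros Hf Hg Hl.
  apply is_lim_mult with (lf := lf) (lg := Finite (/ lg)); [exact Hf| |exact I].
  apply is_lim_inv with (l := Finite lg); [exact Hg|].
  intros E; apply Hl; now injection E.
Qed.

Lemma is_lim_mult_finite (f g : R -> R) (x : Rbar) (lf lg : R) :
  is_lim f x lf -> is_lim g x lg -> is_lim (fun y => f y * g y) x (lf * lg).
Proof. intros Hf Hg; apply is_lim_mult with (lf := lf) (lg := lg); now try exact I. Qed.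

(** The [0/0] form at infinity. The mean value estimate is kept multiplied by [G x - G y], which
    need not be known to be nonzero, and in that form it passes to the limit in [y]. *)
Lemma lhopital_p_infty (F G dF dG : R -> R) (L : R) :
  Rbar_locally p_infty (fun y => is_derive F y (dF y) /\ is_derive G y (dG y)
                                 /\ dG y <> 0 /\ G y <> 0) ->
  is_lim F p_infty 0 -> is_lim G p_infty 0 ->
  is_lim (fun y => dF y / dG y) p_infty L ->
  is_lim (fun y => F y / G y) p_infty L.
Proof.
  intros [M HM] HF HG Hq; apply is_lim_spec; intros eps.
  apply is_lim_spec in Hq; destruct (Hq (pos_div_2 eps)) as [M' HM']; cbn in HM'.
  exists (Rmax M M'); intros x Hx.
  assert (HxM : M < x) by (eapply Rle_lt_trans; [apply Rmax_l|exact Hx]).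
  assert (HxM' : M' < x) by (eapply Rle_lt_trans; [apply Rmax_r|exact Hx]).
  (* Cauchy's mean value theorem on [[x, y]], then [y -> +oo] *)
  assert (Hxy : forall y, x < y ->
            Rabs ((F x - F y) - L * (G x - G y)) <= eps / 2 * Rabs (G x - G y)).
  { intros y Hy.
    set (H := fun s => (F y - F x) * G s - (G y - G x) * F s).
    assert (DH : forall s, x <= s -> is_derive H s ((F y - F x) * dG s - (G y - G x) * dF s)).
    { intros s Hs; destruct (HM s ltac:(lra)) as [H1 [H2 _]].
      apply (is_derive_minus (fun s => (F y - F x) * G s) (fun s => (G y - G x) * F s));
        now apply is_derive_scal. }
    destruct (MVT_gen H x y (fun s => (F y - F x) * dG s - (G y - G x) * dF s)) as [c [Hc Ec]].
    - rewrite Rmin_left, Rmax_right by lra; intros s Hs; apply DH; lra.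
    - rewrite Rmin_left, Rmax_right by lra; intros s Hs.
      apply continuity_pt_filterlim, (ex_derive_continuous H); eexists; apply DH; lra.
    - rewrite Rmin_left, Rmax_right in Hc by lra.
      destruct (HM c ltac:(lra)) as [_ [_ [H3 _]]].
      specialize (HM' c ltac:(lra)).
      assert (E : (F y - F x) * dG c - (G y - G x) * dF c = 0).
      { apply Rmult_eq_reg_r with (y - x); [rewrite <- Ec; unfold H; ring|lra]. }
      replace (F x - F y) with (dF c / dG c * (G x - G y)).
      + replace (dF c / dG c * (G x - G y) - L * (G x - G y))
          with ((dF c / dG c - L) * (G x - G y)) by ring.
        rewrite Rabs_mult; apply Rmult_le_compat_r; [apply Rabs_pos|lra].
      + apply Rmult_eq_reg_r with (dG c); [|exact H3].
        replace (dF c / dG c * (G x - G y) * dG c) with (dF c * (G x - G y)) by (field; exact H3).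
        lra. }
  assert (Hle : Rabs ((F x - 0) - L * (G x - 0)) <= eps / 2 * Rabs (G x - 0)).
  { assert (HFx := is_lim_minus' _ _ _ _ _ (is_lim_const (F x) p_infty) HF).
    assert (HGx := is_lim_minus' _ _ _ _ _ (is_lim_const (G x) p_infty) HG).
    apply (is_lim_le_loc (fun y => Rabs ((F x - F y) - L * (G x - G y)))
             (fun y => eps / 2 * Rabs (G x - G y)) p_infty
             (Rabs ((F x - 0) - L * (G x - 0))) (eps / 2 * Rabs (G x - 0))).
    - exists x; exact Hxy.
    - apply (is_lim_Rabs _ p_infty (Finite _)).
      apply is_lim_minus'; [exact HFx|].
      now apply is_lim_mult_finite; [apply is_lim_const|].
    - apply is_lim_mult_finite; [apply is_lim_const|].
      now apply (is_lim_Rabs _ p_infty (Finite _)). }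
  destruct (HM x HxM) as [_ [_ [_ HG0]]].
  rewrite !Rminus_0_r in Hle.
  replace (F x / G x - L) with ((F x - L * G x) / G x) by (field; exact HG0).
  assert (Hp := Rabs_pos_lt _ HG0).
  rewrite Rabs_div by exact HG0.
  apply Rlt_div_l; [lra|]. pose proof (cond_pos eps); nra.
Qed.

(** The connection formula taken as definition: it makes sense for every non-integer [a], whereas
    the Laplace integral for [U] needs [a > 0]. *)
Definition TricomiU (a b y : R) : R :=
  Gamma (1 - b) / Gamma (a + 1 - b) * KummerM a b y
  + Gamma (b - 1) / Gamma a * (Rpower y (1 - b) * KummerM (a + 1 - b) (2 - b) y).

(* Both [U] and [y^-a] are subdominant to [M = M(a,b,y)], so [U/M] and [y^-a/M]
   tend to [0]; the Wronskian gives [(U/M)'] in closed form, and L'Hopital's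
   rule then yields the constant. *)
Lemma is_lim_TricomiU (a b : R) :
  nonint a -> nonint b -> nonint (a + 1 - b) ->
  is_lim (fun y => Rpower y a * TricomiU a b y) p_infty 1.
Proof.
  intros Ha Hb Hab.
  assert (Hb2 : nonint (2 - b)).
  { replace (2 - b) with (- b + 2) by ring; apply (nonint_plus_IZR (- b) 2), nonint_opp, Hb. }
  assert (Hb1 : nonint (1 - b)).
  { replace (1 - b) with (- b + 1) by ring; apply nonint_succ, nonint_opp, Hb. }
  assert (Hbm : nonint (b - 1)) by (apply (nonint_plus_IZR b (-1)), Hb).
  assert (Ga := Gamma_neq0 a Ha); assert (Gb := Gamma_neq0 b Hb).
  assert (Gab := Gamma_neq0 _ Hab).
  assert (Gbm := Gamma_neq0 _ Hbm).
  assert (Eb : Gamma b = (b - 1) * Gamma (b - 1)).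
  { rewrite <- Gamma_succ by exact Hbm; f_equal; ring. }
  assert (Eb2 : Gamma (2 - b) = (1 - b) * Gamma (1 - b)).
  { rewrite <- Gamma_succ by exact Hb1; f_equal; ring. }
  assert (Ha0 : a <> 0) by exact (Ha 0%Z).
  assert (Hb0 : b <> 0) by exact (Hb 0%Z).
  assert (Hbm0 : b - 1 <> 0) by exact (Hbm 0%Z).
  set (kap := Gamma b / Gamma a).
  assert (Hkap : kap <> 0).
  { apply Rmult_integral_contrapositive; split; [exact Gb|now apply Rinv_neq_0_compat]. }
  set (m := fun y => KummerM a b y * exp (- y) * Rpower y (b - a)).
  assert (Hm : is_lim m p_infty kap) by now apply is_lim_KummerM.
  (* Under the same normalisation the derivative has the same limit as [m], since [a/b *
     Gamma(b+1)/Gamma(a+1) = Gamma b / Gamma a]. *)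
  set (m' := fun y => KummerM_d1 a b y * exp (- y) * Rpower y (b - a)).
  assert (Hm' : is_lim m' p_infty kap).
  { assert (H := is_lim_KummerM _ _ (nonint_succ a Ha) (nonint_succ b Hb)).
    replace kap with (a / b * (Gamma (b + 1) / Gamma (a + 1))).
    2:{ rewrite !Gamma_succ by assumption; unfold kap; field; repeat split; assumption. }
    apply is_lim_ext with (fun y => a / b *
      (KummerM (a + 1) (b + 1) y * exp (- y) * Rpower y (b + 1 - (a + 1)))).
    - intros y; unfold m', KummerM_d1; replace (b + 1 - (a + 1)) with (b - a) by ring; ring.
    - apply is_lim_mult_finite; [apply is_lim_const|exact H]. }
  set (m2 := fun y => KummerM (a + 1 - b) (2 - b) y * exp (- y) * Rpower y (2 - b - (a + 1 - b))).
  assert (Hm2 : is_lim m2 p_infty (Gamma (2 - b) / Gamma (a + 1 - b))) by now apply is_lim_KummerM.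
  (* The derivative of [y^-a / M], stripped of the factor [exp y * y^-b / M^2]; the same factor
     appears in [(U/M)'] and will cancel in the quotient. *)
  set (den := fun y => - a * / y * m y - m' y).
  assert (Hden : is_lim den p_infty (- kap)).
  { replace (- kap) with (- a * 0 * kap - kap) by ring.
    apply is_lim_minus'; [|exact Hm'].
    apply is_lim_mult_finite; [|exact Hm].
    apply is_lim_mult_finite; [apply is_lim_const|].
    apply (is_lim_inv (fun y => y) p_infty p_infty); [apply is_lim_id|discriminate]. }
  (* All powers are reduced to [y^-a] and [y^-b], treated as independent atoms by [field]. *)
  assert (Hpow : forall y, 0 < y ->
     Rpower y (b - a) = Rpower y (- a) / Rpower y (- b)
     /\ Rpower y (1 - b) = y * Rpower y (- b)
     /\ Rpower y (- a - 1) = Rpower y (- a) / y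
     /\ Rpower y (- b) <> 0 /\ Rpower y (- a) <> 0
     /\ Rpower y (1 - b - 1) = Rpower y (- b)
     /\ Rpower y (2 - b - (a + 1 - b)) = y * Rpower y (- a)
     /\ Rpower y (b - 2 * a) = Rpower y (- a) * Rpower y (- a) / Rpower y (- b)
     /\ Rpower y a = / Rpower y (- a)).
  { intros y Hy.
    assert (Hq := Rpower_pos y (- b)); assert (Hp := Rpower_pos y (- a)).
    assert (Ei : forall c, Rpower y c = / Rpower y (- c)).
    { intros c; rewrite Rpower_Ropp, Rinv_inv; reflexivity. }
    repeat split; try lra; try apply Ei.
    - replace (b - a) with (- a + b) by ring; rewrite Rpower_plus, (Ei b); reflexivity.
    - unfold Rminus; rewrite Rpower_plus, Rpower_1 by exact Hy; reflexivity.
    - unfold Rminus; rewrite Rpower_plus, (Rpower_Ropp y 1), Rpower_1 by exact Hy; reflexivity.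
    - f_equal; ring.
    - replace (2 - b - (a + 1 - b)) with (1 + - a) by ring.
      rewrite Rpower_plus, Rpower_1 by exact Hy; reflexivity.
    - replace (b - 2 * a) with (- a + - a + b) by ring.
      rewrite !Rpower_plus, (Ei b); reflexivity. }
  set (A := Gamma (1 - b) / Gamma (a + 1 - b)).
  set (B := Gamma (b - 1) / Gamma a).
  set (F := fun y => TricomiU a b y / KummerM a b y).
  set (G := fun y => Rpower y (- a) / KummerM a b y).
  (* In [(U/M)'] the [A] part of [U] contributes nothing; what remains is [B] times the Wronskian
     over [M^2]. *)
  set (dF := fun y => B * (1 - b) * (Rpower y (- b) * exp y) / KummerM a b y ^ 2).
  set (dG := fun y => (- a * Rpower y (- a - 1) * KummerM a b y
                       - Rpower y (- a) * KummerM_d1 a b y) / KummerM a b y ^ 2).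
  assert (Hev : Rbar_locally p_infty (fun y => 0 < y /\ KummerM a b y <> 0 /\ den y <> 0)).
  { apply filter_and; [now exists 0|]. apply filter_and.
    - eapply filter_imp; [|exact (is_lim_neq0 m kap Hm Hkap)].
      intros y Hy E; apply Hy; unfold m; rewrite E; ring.
    - apply (is_lim_neq0 den (- kap) Hden); lra. }
  assert (HdG : forall y, 0 < y -> KummerM a b y <> 0 ->
            dG y = den y * (exp y * Rpower y (- b)) / KummerM a b y ^ 2).
  { intros y Hy HM; destruct (Hpow y Hy) as [E1 [E2 [E3 [N1 [N2 _]]]]].
    unfold dG, den, m, m'; rewrite E1, E3, exp_Ropp.
    assert (He := exp_pos y). field; repeat split; try assumption; lra. }
  apply is_lim_ext_loc with (fun y => F y / G y).
  { eapply filter_imp; [|exact Hev]; intros y [Hy [HM _]].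
    destruct (Hpow y Hy) as [_ [_ [_ [_ [N2 [_ [_ [_ Ea]]]]]]]].
    unfold F, G; rewrite Ea; field; split; assumption. }
  apply lhopital_p_infty with dF dG.
  - eapply filter_imp; [|exact Hev]; intros y [Hy [HM Hd]].
    destruct (Hpow y Hy) as [E1 [E2 [E3 [N1 [N2 [E4 _]]]]]].
    assert (He := exp_pos y).
    assert (D1 := is_derive_KummerM a b y Ha Hb).
    assert (D2 := is_derive_KummerM _ _ y Hab Hb2).
    split; [|split; [|split]].
    + assert (W := kummer_wronskian a b y Ha Hb Hab Hy).
      assert (DN := is_derive_mult _ _ y _ _ (is_derive_Rpower (1 - b) y Hy) D2 Rmult_comm).
      assert (DU := is_derive_plus _ _ y _ _ (is_derive_scal _ y A _ D1) (is_derive_scal _ y B _ DN)).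
      assert (DF := is_derive_div _ _ y _ _ DU D1 HM).
      refine (eq_ind _ (is_derive F y) DF _ _).
      unfold dF, plus, mult; cbn -[pow]; unfold mult; cbn -[pow].
      rewrite E4, E2.
      replace (B * (1 - b) * (Rpower y (- b) * exp y)) with (B * Rpower y (- b) * ((1 - b) * exp y)) by ring.
      rewrite <- W; field; assumption.
    + apply (is_derive_div (fun y => Rpower y (- a))); [now apply is_derive_Rpower|exact D1|exact HM].
    + rewrite HdG by assumption.
      assert (0 < exp y * Rpower y (- b)) by (apply Rmult_lt_0_compat; [exact He|apply Rpower_pos]).
      apply Rmult_integral_contrapositive; split; [|now apply Rinv_neq_0_compat, pow_nonzero].
      apply Rmult_integral_contrapositive; split; [exact Hd|lra].
    + apply Rmult_integral_contrapositive; split; [exact N2|now apply Rinv_neq_0_compat].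
  - apply is_lim_ext_loc with (fun y => A + B * (m2 y / m y)).
    { eapply filter_imp; [|exact Hev]; intros y [Hy [HM _]].
      destruct (Hpow y Hy) as [E1 [E2 [E3 [N1 [N2 [_ [E5 _]]]]]]].
      unfold F, TricomiU, m2, m; fold A B; rewrite E1, E2, E5.
      pose proof (exp_pos (- y)). field; repeat split; try assumption; lra. }
    (* The dominant exponentials cancel here: [Gamma b = (b-1) Gamma(b-1)] and
       [Gamma(2-b) = (1-b) Gamma(1-b)] turn the second summand into [- A]. *)
    replace 0 with (A + B * (Gamma (2 - b) / Gamma (a + 1 - b) / kap)).
    2:{ unfold A, B, kap; rewrite Eb2, Eb; field; repeat split; assumption. }
    apply is_lim_plus'; [apply is_lim_const|].
    apply is_lim_mult_finite; [apply is_lim_const|].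
    now apply is_lim_div_finite.
  - apply is_lim_ext_loc with (fun y => (exp (- y) * Rpower y (b - 2 * a)) / m y).
    { eapply filter_imp; [|exact Hev]; intros y [Hy [HM _]].
      destruct (Hpow y Hy) as [E1 [_ [_ [N1 [N2 [_ [_ [E6 _]]]]]]]].
      unfold G, m; rewrite E1, E6.
      pose proof (exp_pos (- y)). field; repeat split; try assumption; lra. }
    replace 0 with (0 / kap) by (field; exact Hkap).
    apply is_lim_div_finite; [apply is_lim_exp_neg_Rpower|exact Hm|exact Hkap].
  - apply is_lim_ext_loc with (fun y => B * (1 - b) / den y).
    { eapply filter_imp; [|exact Hev]; intros y [Hy [HM Hd]].
      destruct (Hpow y Hy) as [_ [_ [_ [N1 _]]]].
      rewrite HdG by assumption; unfold dF.
      pose proof (exp_pos y). field; repeat split; try assumption; lra. }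
    (* The coefficient [Gamma(b-1)/Gamma a] of [U] is exactly what normalises the limit to 1. *)
    replace (Finite 1) with (Finite (B * (1 - b) / - kap)).
    2:{ f_equal; unfold B, kap; rewrite Eb; field; repeat split; assumption. }
    apply is_lim_div_finite; [apply is_lim_const|exact Hden|lra].
Qed.

(** By Kummer's transformation both terms decay like the same power [y^-a], so the limit is a
    difference of two constants. The minus sign reflects the real cube root: for [b = 2/3],
    [y^(1-b)] changes sign with [y]. *)
Lemma is_lim_TricomiU_neg (a b : R) :
  nonint a -> nonint b -> nonint (b - a) ->
  is_lim (fun y => Rpower y a *
    (Gamma (1 - b) / Gamma (a + 1 - b) * KummerM a b (- y)
     - Gamma (b - 1) / Gamma a * (Rpower y (1 - b) * KummerM (a + 1 - b) (2 - b) (- y)))) p_infty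
    (Gamma (1 - b) * Gamma b / (Gamma (a + 1 - b) * Gamma (b - a))
     - Gamma (b - 1) * Gamma (2 - b) / (Gamma a * Gamma (1 - a))).
Proof.
  intros Ha Hb Hba.
  assert (Hb2 : nonint (2 - b)).
  { replace (2 - b) with (- b + 2) by ring; apply (nonint_plus_IZR (- b) 2), nonint_opp, Hb. }
  assert (Ha1 : nonint (1 - a)).
  { replace (1 - a) with (- a + 1) by ring; apply nonint_succ, nonint_opp, Ha. }
  assert (Hab : nonint (a + 1 - b)).
  { replace (a + 1 - b) with (- (b - a) + 1) by ring; apply nonint_succ, nonint_opp, Hba. }
  assert (L1 := is_lim_KummerM _ _ Hba Hb).
  assert (L2 := is_lim_KummerM _ _ Ha1 Hb2).
  apply is_lim_ext_loc with (fun y =>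
    Gamma (1 - b) / Gamma (a + 1 - b) * (KummerM (b - a) b y * exp (- y) * Rpower y (b - (b - a)))
    - Gamma (b - 1) / Gamma a
      * (KummerM (1 - a) (2 - b) y * exp (- y) * Rpower y (2 - b - (1 - a)))).
  { exists 0; intros y Hy.
    rewrite (KummerM_transform a b y Hba Hb), (KummerM_transform (a + 1 - b) (2 - b) y).
    2:{ now replace (2 - b - (a + 1 - b)) with (1 - a) by ring. }
    2:{ exact Hb2. }
    replace (2 - b - (a + 1 - b)) with (1 - a) by ring.
    replace (b - (b - a)) with a by ring.
    replace (2 - b - (1 - a)) with (a + (1 - b)) by ring.
    rewrite Rpower_plus; ring. }
  replace (Gamma (1 - b) * Gamma b / (Gamma (a + 1 - b) * Gamma (b - a))
     - Gamma (b - 1) * Gamma (2 - b) / (Gamma a * Gamma (1 - a)))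
    with (Gamma (1 - b) / Gamma (a + 1 - b) * (Gamma b / Gamma (b - a))
          - Gamma (b - 1) / Gamma a * (Gamma (2 - b) / Gamma (1 - a)))
    by (field; repeat split; now apply Gamma_neq0).
  apply is_lim_minus'; (apply is_lim_mult_finite; [apply is_lim_const|assumption]).
Qed.

Lemma Gamma_reflection_succ (x : R) :
  nonint x -> Gamma (x + 1) * Gamma (1 - (x + 1)) = - (Gamma x * Gamma (1 - x)).
Proof.
  intros Hx; rewrite Gamma_succ by exact Hx.
  replace (Gamma (1 - x)) with (- x * Gamma (1 - (x + 1))); [ring|].
  replace (1 - (x + 1)) with (- x) by ring.
  rewrite <- Gamma_succ by now apply nonint_opp.
  f_equal; ring.
Qed.

(** Both sides equal [(-1)^k Gamma x Gamma(1-x)], one by shifting up [k] times and the other by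
    shifting down. *)
Lemma Gamma_reflection_sym (x : R) (k : Z) :
  nonint x ->
  Gamma (x + IZR k) * Gamma (1 - (x + IZR k)) = Gamma (x - IZR k) * Gamma (1 - (x - IZR k)).
Proof.
  intros Hx.
  assert (Hm : forall m : Z, nonint (x - IZR m)).
  { intros m; unfold Rminus; rewrite <- opp_IZR; now apply nonint_plus_IZR. }
  assert (Hp : forall m : Z, nonint (x + IZR m)) by (intros m; now apply nonint_plus_IZR).
  induction k as [|m IH|m IH] using Z.peano_ind.
  - now rewrite Rplus_0_r, Rminus_0_r.
  - rewrite succ_IZR, <- Rplus_assoc, Gamma_reflection_succ, IH by apply Hp.
    assert (E := Gamma_reflection_succ (x - IZR (Z.succ m)) (Hm _)).
    rewrite succ_IZR in E; replace (x - (IZR m + 1) + 1) with (x - IZR m) in E by ring.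
    rewrite E; ring.
  - assert (E := Gamma_reflection_succ (x + IZR (Z.pred m)) (Hp _)).
    assert (E' := Gamma_reflection_succ (x - IZR m) (Hm _)).
    replace (x + IZR (Z.pred m) + 1) with (x + IZR m) in E by (unfold Z.pred; rewrite plus_IZR; ring).
    replace (x - IZR m + 1) with (x - IZR (Z.pred m)) in E' by (unfold Z.pred; rewrite plus_IZR; ring).
    rewrite E', <- IH, E; ring.
Qed.

(** * Smoothness *)

(** Derivatives are supplied as functions on the whole line, so that sums, products and compositions
    are handled by plain induction on the order. *)
Fixpoint smooth_upto (n : nat) (f : R -> R) : Prop :=
  match n with
  | O => True
  | S m => exists df : R -> R, (forall x, is_derive f x (df x)) /\ smooth_upto m df
  end.

Lemma smooth_upto_ext (n : nat) : forall f g : R -> R,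
  (forall x, f x = g x) -> smooth_upto n f -> smooth_upto n g.
Proof.
  destruct n as [|n]; intros f g E; [easy|].
  intros [df [Hf Hn]]; exists df; split; [|exact Hn].
  intros x; now apply is_derive_ext with f.
Qed.

Lemma smooth_upto_pred (n : nat) : forall f : R -> R, smooth_upto (S n) f -> smooth_upto n f.
Proof.
  induction n as [|n IH]; intros f [df [Hf Hn]]; [exact I|].
  exists df; split; [exact Hf|now apply IH].
Qed.

Lemma smooth_upto_const (n : nat) : forall c : R, smooth_upto n (fun _ => c).
Proof.
  induction n as [|n IH]; intros c; [exact I|].
  exists (fun _ => 0); split; [intros x; apply (is_derive_const c)|apply IH].
Qed.

Lemma smooth_upto_id (n : nat) : smooth_upto n (fun x => x).
Proof.
  destruct n as [|n]; [exact I|].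
  exists (fun _ => 1); split; [intros x; apply (is_derive_id x)|apply smooth_upto_const].
Qed.

Lemma smooth_upto_plus (n : nat) : forall f g : R -> R,
  smooth_upto n f -> smooth_upto n g -> smooth_upto n (fun x => f x + g x).
Proof.
  induction n as [|n IH]; intros f g; [easy|].
  intros [df [Hf Hdf]] [dg [Hg Hdg]]; exists (fun x => df x + dg x); split; [|now apply IH].
  intros x; now apply (is_derive_plus f g).
Qed.

Lemma smooth_upto_mult (n : nat) : forall f g : R -> R,
  smooth_upto n f -> smooth_upto n g -> smooth_upto n (fun x => f x * g x).
Proof.
  induction n as [|n IH]; intros f g; [easy|].
  intros Sf Sg.
  assert (Tf := smooth_upto_pred n f Sf); assert (Tg := smooth_upto_pred n g Sg).
  destruct Sf as [df [Hf Hdf]]; destruct Sg as [dg [Hg Hdg]].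
  exists (fun x => df x * g x + f x * dg x); split.
  - intros x; apply (is_derive_mult f g x); [apply Hf|apply Hg|exact Rmult_comm].
  - apply smooth_upto_plus; now apply IH.
Qed.

Lemma smooth_upto_comp (n : nat) : forall f g : R -> R,
  smooth_upto n f -> smooth_upto n g -> smooth_upto n (fun x => f (g x)).
Proof.
  induction n as [|n IH]; intros f g; [easy|].
  intros [df [Hf Hdf]] Sg; assert (Tg := smooth_upto_pred n g Sg).
  destruct Sg as [dg [Hg Hdg]].
  exists (fun x => dg x * df (g x)); split.
  - intros x; apply (is_derive_comp f g x); [apply Hf|apply Hg].
  - apply smooth_upto_mult; [exact Hdg|now apply IH].
Qed.

(** The derivative is a multiple of another Kummer function, hence an induction over all
    parameters. *)
Lemma smooth_upto_KummerM (n : nat) : forall a b : R,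
  nonint a -> nonint b -> smooth_upto n (KummerM a b).
Proof.
  induction n as [|n IH]; intros a b Ha Hb; [exact I|].
  exists (KummerM_d1 a b); split; [intros x; now apply is_derive_KummerM|].
  apply (smooth_upto_mult n (fun _ => a / b)); [apply smooth_upto_const|].
  apply IH; now apply nonint_succ.
Qed.

Lemma smooth_upto_Rpower (n : nat) : forall p : R, smooth_upto n (fun t => Rpower (1 + t ^ 2) p).
Proof.
  induction n as [|n IH]; intros p; [exact I|].
  exists (fun t => 2 * t * (p * Rpower (1 + t ^ 2) (p - 1))); split.
  - intros t; apply (is_derive_comp (fun u => Rpower u p) (fun t => 1 + t ^ 2)).
    + apply is_derive_Rpower; nra.
    + auto_derive; [exact I|ring].
  - apply (smooth_upto_mult n (fun t => 2 * t)).
    + apply smooth_upto_mult; [apply smooth_upto_const|apply smooth_upto_id].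
    + apply smooth_upto_mult; [apply smooth_upto_const|apply IH].
Qed.

Lemma smooth_upto_ex_derive_n (n : nat) : forall (f : R -> R) (x : R),
  smooth_upto n f -> ex_derive_n f n x.
Proof.
  induction n as [|n IH]; intros f x; [easy|].
  intros [df [Hf Hn]]; destruct n as [|n]; [now exists (df x)|].
  (* [smooth_upto] peels off the innermost derivative while [Derive_n] adds the outermost one;
     [Derive_n_comp] reconciles the two orders. *)
  apply ex_derive_ext with (Derive_n df n); [|exact (IH df x Hn)].
  intros t; transitivity (Derive_n (Derive f) n t).
  - apply Derive_n_ext; intros s; symmetry; apply is_derive_unique, Hf.
  - change (Derive f) with (Derive_n f 1); rewrite Derive_n_comp, Nat.add_1_r; reflexivity.
Qed.

(** * The functions Lambda_k and v_k *)

(** All parameters in play are sixths of integers, so being a non-integer becomes a divisibility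
    question for [lia]. *)
Lemma nonint_sixth (x : R) (p : Z) :
  6 * x = IZR p -> (forall m : Z, p <> 6 * m)%Z -> nonint x.
Proof.
  intros E Hp m Em; apply (Hp m), eq_IZR; rewrite mult_IZR; lra.
Qed.

Lemma nonint_two_thirds : nonint (2 / 3).
Proof. apply nonint_sixth with 4%Z; [lra|lia]. Qed.

Lemma nonint_four_thirds : nonint (4 / 3).
Proof. apply nonint_sixth with 8%Z; [lra|lia]. Qed.

Lemma nonint_opp_sixth_minus (k : Z) : nonint (- (1 / 6) - IZR k).
Proof.
  apply nonint_sixth with (-1 - 6 * k)%Z; [rewrite minus_IZR, mult_IZR; lra|lia].
Qed.

Lemma nonint_sixth_minus (k : Z) : nonint (1 / 6 - IZR k).
Proof.
  apply nonint_sixth with (1 - 6 * k)%Z; [rewrite minus_IZR, mult_IZR; lra|lia].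
Qed.

(** The bracket of [Lambda] without its algebraic prefactor: this is the part that satisfies a
    linear differential equation. *)
Definition kummer_profile (k : Z) (t : R) : R :=
  Gamma (1/3) / Gamma (1/6 - IZR k) * KummerM (-(1/6) - IZR k) (2/3) (- t^3 / 9)
  - t / Rpower 9 (1/3) * (Gamma (-(1/3)) / Gamma (-(1/6) - IZR k))
      * KummerM (1/6 - IZR k) (4/3) (- t^3 / 9).

Lemma Lambda_profile (k : Z) (t : R) :
  Lambda k t = Rpower 9 (1/6 + IZR k) * Rpower (1 + t^2) (-(1/4) - 3 * IZR k / 2)
               * kummer_profile k t.
Proof. reflexivity. Qed.

Lemma smooth_upto_kummer_profile (k : Z) (n : nat) : smooth_upto n (kummer_profile k).
Proof.
  assert (Hz : smooth_upto n (fun t => - t ^ 3 / 9)).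
  { apply smooth_upto_ext with (fun t => - / 9 * (t * (t * t))); [intros t; field|].
    repeat apply smooth_upto_mult; try apply smooth_upto_id; apply smooth_upto_const. }
  apply smooth_upto_ext with (fun t =>
    Gamma (1/3) / Gamma (1/6 - IZR k) * KummerM (-(1/6) - IZR k) (2/3) (- t^3 / 9)
    + (- (/ Rpower 9 (1/3) * (Gamma (-(1/3)) / Gamma (-(1/6) - IZR k))) * t)
      * KummerM (1/6 - IZR k) (4/3) (- t^3 / 9)).
  { intros t; unfold kummer_profile, Rdiv; ring. }
  apply smooth_upto_plus; apply smooth_upto_mult.
  - apply smooth_upto_const.
  - apply (smooth_upto_comp n (KummerM _ _)); [|exact Hz].
    apply smooth_upto_KummerM; [apply nonint_opp_sixth_minus|apply nonint_two_thirds].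
  - apply smooth_upto_mult; [apply smooth_upto_const|apply smooth_upto_id].
  - apply (smooth_upto_comp n (KummerM _ _)); [|exact Hz].
    apply smooth_upto_KummerM; [apply nonint_sixth_minus|apply nonint_four_thirds].
Qed.

Lemma smooth_upto_Lambda (k : Z) (n : nat) : smooth_upto n (Lambda k).
Proof.
  apply (smooth_upto_mult n (fun t => Rpower 9 (1/6 + IZR k)
                                      * Rpower (1 + t^2) (-(1/4) - 3 * IZR k / 2)));
    [|apply smooth_upto_kummer_profile].
  apply smooth_upto_mult; [apply smooth_upto_const|apply smooth_upto_Rpower].
Qed.

(** * Limits of [Lambda] at both ends *)

(** With [a = -1/6 - k] the exponent of [1 + t^2] is [3a/2], so the prefactor behaves like
    [9^-a t^(3a) = (t^3/9)^a], which is the normalising power of the limits for [TricomiU]. *)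
Lemma Lambda_prefactor (k : Z) (t : R) :
  0 < t ->
  Rpower 9 (1/6 + IZR k) * Rpower (1 + t^2) (-(1/4) - 3 * IZR k / 2)
  = Rpower (t ^ 3 / 9) (-(1/6) - IZR k)
    * Rpower (1 + / t * / t) (-(1/4) - 3 * IZR k / 2).
Proof.
  intros Ht.
  assert (Hi : 0 < / t) by now apply Rinv_0_lt_compat.
  assert (Hi2 : 0 < 1 + / t * / t) by nra.
  assert (E1 : ln (1 + t ^ 2) = 2 * ln t + ln (1 + / t * / t)).
  { replace (1 + t ^ 2) with ((t * t) * (1 + / t * / t)) by (field; lra).
    rewrite (ln_mult (t * t)) by nra; rewrite (ln_mult t t) by exact Ht; ring. }
  assert (E2 : ln (t ^ 3 / 9) = 3 * ln t - ln 9).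
  { rewrite Rcomplements.ln_div, ln_pow by (try apply pow_lt; lra); cbn; ring. }
  unfold Rpower; rewrite E1, E2, <- !exp_plus; f_equal; field.
Qed.

Lemma Rpower_third_cube (t : R) : 0 < t -> Rpower (t ^ 3 / 9) (1/3) = t / Rpower 9 (1/3).
Proof.
  intros Ht; rewrite Rpower_div by (try apply pow_lt; lra); f_equal.
  rewrite <- Rpower_pow, Rpower_mult by exact Ht.
  replace (INR 3 * (1 / 3)) with 1 by (cbn; field); now apply Rpower_1.
Qed.

(** The Gamma quotients in [Lambda] are the connection coefficients of [U] at [b = 2/3], where
    [a + 1 - b = 1/6 - k] and [y^(1-b) = t / 9^(1/3)]. *)
Lemma kummer_profile_opp (k : Z) (t : R) :
  0 < t -> kummer_profile k (- t) = TricomiU (-(1/6) - IZR k) (2/3) (t ^ 3 / 9).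
Proof.
  intros Ht; unfold kummer_profile, TricomiU.
  replace (1 - 2/3) with (1/3) by field.
  replace (-(1/6) - IZR k + 1 - 2/3) with (1/6 - IZR k) by field.
  replace (2/3 - 1) with (-(1/3)) by field.
  replace (2 - 2/3) with (4/3) by field.
  replace (- (- t) ^ 3 / 9) with (t ^ 3 / 9) by field.
  rewrite Rpower_third_cube by exact Ht; unfold Rdiv; ring.
Qed.

Lemma is_lim_cube_ninth : is_lim (fun t => t ^ 3 / 9) p_infty p_infty.
Proof.
  apply is_lim_spec; intros M; exists (Rmax 3 M); intros t Ht.
  assert (3 < t) by (eapply Rle_lt_trans; [apply Rmax_l|exact Ht]).
  assert (M < t) by (eapply Rle_lt_trans; [apply Rmax_r|exact Ht]).
  assert (0 < t * (t * t - 9)) by (apply Rmult_lt_0_compat; nra).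
  cbn [pow]; lra.
Qed.

Lemma is_lim_cube_ninth_comp (f : R -> R) (l : R) :
  is_lim f p_infty l -> is_lim (fun t => f (t ^ 3 / 9)) p_infty l.
Proof.
  intros H; apply is_lim_comp with p_infty; [exact H|apply is_lim_cube_ninth|].
  exists 0; intros t _; discriminate.
Qed.

Lemma is_lim_Rpower_1 (p : R) : is_lim (fun t => Rpower (1 + / t * / t) p) p_infty 1.
Proof.
  replace (Finite 1) with (Finite (Rpower 1 p))
    by (unfold Rpower; now rewrite ln_1, Rmult_0_r, exp_0).
  apply (is_lim_comp_continuous (fun t => 1 + / t * / t) (fun u => Rpower u p)).
  - replace (Finite 1) with (Finite (1 + 0 * 0)) by (f_equal; ring).
    assert (Hi : is_lim (fun t => / t) p_infty 0)
      by (apply (is_lim_inv (fun t => t) p_infty p_infty); [apply is_lim_id|discriminate]).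
    apply is_lim_plus'; [apply is_lim_const|now apply is_lim_mult_finite].
  - apply (ex_derive_continuous (fun u => Rpower u p)); eexists; apply is_derive_Rpower; lra.
Qed.

Lemma is_lim_Lambda_m_infty (k : Z) : is_lim (Lambda k) m_infty 1.
Proof.
  assert (H : is_lim (fun t => Lambda k (- t)) p_infty 1).
  { set (a := -(1/6) - IZR k).
    apply is_lim_ext_loc with (fun t =>
      (Rpower (t ^ 3 / 9) a * TricomiU a (2/3) (t ^ 3 / 9))
      * Rpower (1 + / t * / t) (-(1/4) - 3 * IZR k / 2)).
    { exists 0; intros t Ht; rewrite Lambda_profile, kummer_profile_opp by exact Ht.
      replace ((- t) ^ 2) with (t ^ 2) by ring.
      rewrite Lambda_prefactor by exact Ht; unfold a; ring. }
    replace (Finite 1) with (Finite (1 * 1)) by (f_equal; ring).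
    apply is_lim_mult_finite; [|apply is_lim_Rpower_1].
    apply (is_lim_cube_ninth_comp (fun y => Rpower y a * TricomiU a (2/3) y)).
    apply is_lim_TricomiU; [apply nonint_opp_sixth_minus|apply nonint_two_thirds|].
    unfold a; replace (-(1/6) - IZR k + 1 - 2/3) with (1/6 - IZR k) by field.
    apply nonint_sixth_minus. }
  apply is_lim_ext with (fun t => Lambda k (- - t)); [intros t; now rewrite Ropp_involutive|].
  apply (is_lim_comp (fun t => Lambda k (- t)) (fun t => - t) m_infty 1 p_infty);
    [exact H|apply (is_lim_opp (fun t => t) m_infty m_infty), is_lim_id|].
  exists 0; intros t _; discriminate.
Qed.

Lemma is_lim_Lambda_p_infty (k : Z) : is_lim (Lambda k) p_infty 0.
Proof.
  set (a := -(1/6) - IZR k).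
  assert (Ha : nonint a) by apply nonint_opp_sixth_minus.
  assert (Hba : nonint (2/3 - a)).
  { apply nonint_sixth with (5 + 6 * k)%Z; [unfold a; rewrite plus_IZR, mult_IZR; lra|lia]. }
  assert (L := is_lim_TricomiU_neg a (2/3) Ha nonint_two_thirds Hba).
  apply is_lim_ext_loc with (fun t =>
    (Rpower (t ^ 3 / 9) a *
      (Gamma (1 - 2/3) / Gamma (a + 1 - 2/3) * KummerM a (2/3) (- (t ^ 3 / 9))
       - Gamma (2/3 - 1) / Gamma a *
         (Rpower (t ^ 3 / 9) (1 - 2/3) * KummerM (a + 1 - 2/3) (2 - 2/3) (- (t ^ 3 / 9)))))
    * Rpower (1 + / t * / t) (-(1/4) - 3 * IZR k / 2)).
  { exists 0; intros t Ht; rewrite Lambda_profile, Lambda_prefactor by exact Ht.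
    unfold kummer_profile; fold a.
    replace (1 - 2/3) with (1/3) by field.
    replace (a + 1 - 2/3) with (1/6 - IZR k) by (unfold a; field).
    replace (2/3 - 1) with (-(1/3)) by field.
    replace (2 - 2/3) with (4/3) by field.
    replace (- (t ^ 3 / 9)) with (- t ^ 3 / 9) by field.
    rewrite Rpower_third_cube by exact Ht; unfold Rdiv; ring. }
  replace (Finite 0) with (Finite (0 * 1)) by (f_equal; ring).
  apply is_lim_mult_finite; [|apply is_lim_Rpower_1].
  apply (is_lim_cube_ninth_comp (fun y => Rpower y a *
      (Gamma (1 - 2/3) / Gamma (a + 1 - 2/3) * KummerM a (2/3) (- y)
       - Gamma (2/3 - 1) / Gamma a *
         (Rpower y (1 - 2/3) * KummerM (a + 1 - 2/3) (2 - 2/3) (- y))))).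
  match type of L with is_lim _ _ ?l => replace (Finite 0) with l; [exact L|f_equal] end.
  clear L.
  assert (H13 : nonint (1/3)) by (apply nonint_sixth with 2%Z; [lra|lia]).
  assert (Hm13 : nonint (-(1/3))) by now apply nonint_opp.
  replace (1 - 2/3) with (1/3) by field.
  replace (2/3 - 1) with (-(1/3)) by field.
  replace (2 - 2/3) with (1/3 + 1) by field.
  rewrite (Gamma_succ (1/3)) by exact H13.
  replace (2/3) with (-(1/3) + 1) at 1 by field.
  rewrite (Gamma_succ (-(1/3))) by exact Hm13.
  (* Both terms carry the factor [Gamma (1/3) * Gamma (-1/3) / 3]; their
     denominators are opposite. *)
  assert (E : Gamma (a + 1 - 2/3) * Gamma (2/3 - a) = - (Gamma a * Gamma (1 - a))).
  { assert (S := Gamma_reflection_sym (1/6) k ltac:(apply nonint_sixth with 1%Z; [lra|lia])).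
    assert (T := Gamma_reflection_succ a Ha).
    replace (a + 1 - 2/3) with (1/6 - IZR k) by (unfold a; field).
    replace (2/3 - a) with (1 - (1/6 - IZR k)) by (unfold a; field).
    rewrite <- S, <- T.
    replace (a + 1) with (1 - (1/6 + IZR k)) by (unfold a; field).
    replace (1 - (1 - (1/6 + IZR k))) with (1/6 + IZR k) by ring; ring. }
  rewrite E.
  assert (Ga := Gamma_neq0 a Ha).
  assert (Ga1 : Gamma (1 - a) <> 0).
  { apply Gamma_neq0; replace (1 - a) with (- a + 1) by ring.
    now apply nonint_succ, nonint_opp. }
  field; split; assumption.
Qed.

Lemma bounded_of_lim (f : R -> R) (l l' : R) :
  (forall t, continuity_pt f t) -> is_lim f m_infty l -> is_lim f p_infty l' ->
  exists B, forall t, Rabs (f t) <= B.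
Proof.
  intros Hc Hm Hp.
  apply is_lim_spec in Hm; destruct (Hm (mkposreal 1 Rlt_0_1)) as [m Hm']; cbn in Hm'.
  apply is_lim_spec in Hp; destruct (Hp (mkposreal 1 Rlt_0_1)) as [M HM']; cbn in HM'.
  (* Nothing orders the two thresholds [m] and [M], hence the compact interval between their minimum
     and maximum. *)
  destruct (continuity_ab_maj (fun t => Rabs (f t)) (Rmin m M) (Rmax m M)) as [x [Hx _]].
  - eapply Rle_trans; [apply Rmin_l|apply Rmax_l].
  - intros c _; apply (continuity_pt_comp f Rabs); [apply Hc|apply Rcontinuity_abs].
  - exists (Rabs (f x) + (Rabs l + 1) + (Rabs l' + 1)); intros t.
    assert (Hl := Rabs_pos l); assert (Hl' := Rabs_pos l'); assert (Hfx := Rabs_pos (f x)).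
    destruct (Rlt_le_dec t m) as [H1|H1].
    { specialize (Hm' t H1); assert (T := Rabs_triang (f t - l) l).
      replace (f t - l + l) with (f t) in T by ring; lra. }
    destruct (Rlt_le_dec M t) as [H2|H2].
    { specialize (HM' t H2); assert (T := Rabs_triang (f t - l') l').
      replace (f t - l' + l') with (f t) in T by ring; lra. }
    specialize (Hx t); cbv beta in Hx.
    assert (Rabs (f t) <= Rabs (f x)); [|lra].
    apply Hx; split; [eapply Rle_trans; [apply Rmin_l|exact H1]|
                      eapply Rle_trans; [exact H2|apply Rmax_r]].
Qed.

(** * The similarity equation and the partial differential equation *)

(** Under [zeta = - t^3/9], Kummer's equation with [b = 2/3] multiplied by [- t] is this equation
    for [M(a,2/3,zeta)], and the one with [b = 4/3] multiplied by [- t^2] is this equation for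
    [t M(a+1/3,4/3,zeta)]. *)
Lemma kummer_profile_ode (k : Z) :
  exists d1 d2 : R -> R,
    (forall t, is_derive (kummer_profile k) t (d1 t)) /\
    (forall t, is_derive d1 t (d2 t)) /\
    (forall t, d2 t + t ^ 2 / 3 * d1 t - (1/6 + IZR k) * t * kummer_profile k t = 0).
Proof.
  set (A := Gamma (1/3) / Gamma (1/6 - IZR k)).
  set (B := / Rpower 9 (1/3) * (Gamma (-(1/3)) / Gamma (-(1/6) - IZR k))).
  set (a := -(1/6) - IZR k); set (a' := 1/6 - IZR k).
  assert (Ha : nonint a) by apply nonint_opp_sixth_minus.
  assert (Ha' : nonint a') by apply nonint_sixth_minus.
  assert (Hb := nonint_two_thirds); assert (Hb' := nonint_four_thirds).
  set (zeta := fun t : R => - t ^ 3 / 9).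
  exists (fun t => A * (- (t ^ 2 / 3) * KummerM_d1 a (2/3) (zeta t))
                   - B * (KummerM a' (4/3) (zeta t) - t ^ 3 / 3 * KummerM_d1 a' (4/3) (zeta t))).
  exists (fun t => A * (- (2 * t / 3) * KummerM_d1 a (2/3) (zeta t)
                        + t ^ 4 / 9 * KummerM_d2 a (2/3) (zeta t))
                   - B * (- (4 * t ^ 2 / 3) * KummerM_d1 a' (4/3) (zeta t)
                          + t ^ 5 / 9 * KummerM_d2 a' (4/3) (zeta t))).
  assert (X0 : forall u, ex_derive (fun x : R => KummerM a (2/3) x) u)
    by (intros u; eexists; now apply is_derive_KummerM).
  assert (X1 : forall u, ex_derive (fun x : R => KummerM_d1 a (2/3) x) u)
    by (intros u; eexists; now apply is_derive_KummerM_d1).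
  assert (X0' : forall u, ex_derive (fun x : R => KummerM a' (4/3) x) u)
    by (intros u; eexists; now apply is_derive_KummerM).
  assert (X1' : forall u, ex_derive (fun x : R => KummerM_d1 a' (4/3) x) u)
    by (intros u; eexists; now apply is_derive_KummerM_d1).
  assert (E : forall t, kummer_profile k t
                = A * KummerM a (2/3) (zeta t) - B * (t * KummerM a' (4/3) (zeta t)))
    by (intros t; unfold kummer_profile, A, B, a, a', zeta, Rdiv; ring).
  split; [|split]; intros t.
  - apply is_derive_ext with
      (fun t => A * KummerM a (2/3) (- t ^ 3 / 9) - B * (t * KummerM a' (4/3) (- t ^ 3 / 9))).
    { intros s; exact (eq_sym (E s)). }
    auto_derive; [repeat split; trivial|].
    rewrite !Derive_KummerM by assumption.
    unfold zeta, Rdiv; cbn [pow Init.Nat.pred INR]; field.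
  - unfold zeta; auto_derive; [repeat split; trivial|].
    rewrite !Derive_KummerM, !Derive_KummerM_d1 by assumption.
    unfold Rdiv; cbn [pow Init.Nat.pred INR]; field.
  - assert (O := KummerM_ode a (2/3) (zeta t) Ha Hb).
    assert (O' := KummerM_ode a' (4/3) (zeta t) Ha' Hb').
    rewrite E; clear E.
    assert (Ea : IZR k = - (1/6) - a) by (unfold a; ring).
    assert (Ea' : a' = a + 1/3) by (unfold a, a'; field).
    revert O O'.
    generalize (KummerM a (2/3) (zeta t)) (KummerM_d1 a (2/3) (zeta t)) (KummerM_d2 a (2/3) (zeta t))
      (KummerM a' (4/3) (zeta t)) (KummerM_d1 a' (4/3) (zeta t)) (KummerM_d2 a' (4/3) (zeta t)).
    intros m d e m' d' e' O O'.
    match goal with |- ?lhs = 0 => replace lhs with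
      (- t * A * (zeta t * e + (2/3 - zeta t) * d - a * m)
       + t ^ 2 * B * (zeta t * e' + (4/3 - zeta t) * d' - a' * m')) end.
    + rewrite O, O'; ring.
    + rewrite Ea', Ea; unfold zeta; field.
Qed.

(** Since [r^2 = x^(2/3) (1 + t^2)], the powers of [1 + t^2] in [r^(1/2+3k)] and in [Lambda] cancel,
    leaving a self-similar function of [x] and [z]. *)
Lemma vk_profile (k : Z) (x z : R) :
  0 < x ->
  vk k x z = Rpower 9 (1/6 + IZR k) * Rpower x (1/6 + IZR k)
             * kummer_profile k (z * Rpower x (-(1/3))).
Proof.
  intros Hx; unfold vk; rewrite Lambda_profile.
  set (t := z * Rpower x (-(1/3))).
  assert (Hs := Rpower_pos x (1/3)).
  assert (E : z ^ 2 + Rpower x (2/3) = Rpower x (2/3) * (1 + t ^ 2)).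
  { replace (2/3) with (1/3 + 1/3) by field.
    unfold t; rewrite Rpower_plus, Rpower_Ropp; field; lra. }
  assert (Ht : 0 < 1 + t ^ 2) by nra.
  assert (H23 := Rpower_pos x (2/3)).
  rewrite E, <- Rpower_sqrt, Rpower_mult by now apply Rmult_lt_0_compat.
  rewrite <- Rpower_mult_distr, Rpower_mult by assumption.
  replace (2/3 * (/ 2 * (1/2 + 3 * IZR k))) with (1/6 + IZR k) by field.
  replace (-(1/4) - 3 * IZR k / 2) with (- (/ 2 * (1/2 + 3 * IZR k))) by field.
  rewrite (Rpower_Ropp (1 + t ^ 2)).
  assert (H := Rpower_pos (1 + t ^ 2) (/ 2 * (1/2 + 3 * IZR k))).
  field; lra.
Qed.

Lemma vk_pde (k : Z) (x z : R) :
  0 < x ->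
  ex_derive (fun x' => vk k x' z) x /\
  ex_derive (fun z' => vk k x z') z /\
  ex_derive (fun z' => Derive (fun z'' => vk k x z'') z') z /\
  z * Derive (fun x' => vk k x' z) x
    - Derive (fun z' => Derive (fun z'' => vk k x z'') z') z = 0.
Proof.
  intros Hx.
  destruct (kummer_profile_ode k) as [d1 [d2 [D1 [D2 O]]]].
  set (al := 1/6 + IZR k) in *; set (c := Rpower 9 al).
  set (s := Rpower x (-(1/3))); set (p := Rpower x al).
  assert (Hs : 0 < s) by apply Rpower_pos.
  assert (Dx : is_derive (fun x' : R => vk k x' z) x
    (c * (al * Rpower x (al - 1) * kummer_profile k (z * s)
          + p * (z * (-(1/3) * Rpower x (-(1/3) - 1)) * d1 (z * s))))).
  { apply is_derive_ext_loc with
      (fun x' => c * (Rpower x' al * kummer_profile k (z * Rpower x' (-(1/3))))).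
    { exists (mkposreal x Hx); intros y Hy; cbn in Hy.
      unfold ball in Hy; cbn in Hy; unfold AbsRing_ball, abs, minus, plus, opp in Hy; cbn in Hy.
      assert (0 < y) by (apply Rabs_def2 in Hy; lra).
      rewrite vk_profile by assumption; symmetry; apply Rmult_assoc. }
    apply is_derive_scal.
    apply (is_derive_mult (fun x' => Rpower x' al)
             (fun x' => kummer_profile k (z * Rpower x' (-(1/3)))));
      [now apply is_derive_Rpower| |exact Rmult_comm].
    apply (is_derive_comp (kummer_profile k) (fun x' => z * Rpower x' (-(1/3)))); [apply D1|].
    now apply is_derive_scal, is_derive_Rpower. }
  assert (Ds : forall z', is_derive (fun z'' : R => z'' * s) z' s)
    by (intros z'; auto_derive; [exact I|ring]).
  assert (Dz : forall z', is_derive (fun z'' : R => vk k x z'') z' (c * p * (s * d1 (z' * s)))).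
  { intros z'; apply is_derive_ext with (fun z'' => c * p * kummer_profile k (z'' * s)).
    { intros y; rewrite vk_profile by exact Hx; reflexivity. }
    apply is_derive_scal.
    now apply (is_derive_comp (kummer_profile k) (fun z'' => z'' * s)). }
  assert (Dzz : is_derive (fun z' : R => Derive (fun z'' => vk k x z'') z') z
                  (c * p * (s * (s * d2 (z * s))))).
  { apply is_derive_ext with (fun z' => c * p * (s * d1 (z' * s))).
    { intros z'; symmetry; apply is_derive_unique, Dz. }
    apply is_derive_scal, is_derive_scal.
    now apply (is_derive_comp d1 (fun z'' => z'' * s)). }
  split; [eexists; exact Dx|]; split; [eexists; apply Dz|]; split; [eexists; exact Dzz|].
  rewrite (is_derive_unique _ _ _ Dx), (is_derive_unique _ _ _ Dzz).
  (* Every power of [x] is expressed through [p] and [s = x^(-1/3)]; both sides of the equation then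
     carry the factor [c p s^2], times the profile equation at [z s]. *)
  assert (Ex : Rpower x (-1) = s ^ 3).
  { unfold s; rewrite <- Rpower_pow, Rpower_mult by apply Rpower_pos; f_equal; cbn; field. }
  assert (E1 : Rpower x (al - 1) = p * s ^ 3)
    by (rewrite <- Ex; unfold Rminus; rewrite Rpower_plus; reflexivity).
  assert (E2 : Rpower x (-(1/3) - 1) = s * s ^ 3)
    by (rewrite <- Ex; unfold Rminus; rewrite Rpower_plus; reflexivity).
  rewrite E1, E2.
  specialize (O (z * s)).
  match goal with |- ?lhs = 0 => replace lhs with
    (- (c * p * s ^ 2) * (d2 (z * s) + (z * s) ^ 2 / 3 * d1 (z * s)
                        - al * (z * s) * kummer_profile k (z * s))) by field end.
  rewrite O; ring.
Qed.

(** * The boundary limit *)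

Lemma filterlim_Rpower_at_right_0 (p : R) :
  0 < p -> filterlim (fun x => Rpower x p) (at_right 0) (locally 0).
Proof.
  intros Hp.
  apply (filterlim_comp _ _ _ (fun x => p * ln x) exp _ (Rbar_locally m_infty)).
  - apply (filterlim_comp _ _ _ ln (fun l => p * l) _ (Rbar_locally m_infty));
      [exact is_lim_ln_0|].
    intros P [M HM]; exists (M / p); intros l Hl; apply HM.
    apply Rlt_div_r in Hl; lra.
  - exact is_lim_exp_m.
Qed.

Lemma filterlim_Rpower_neg_at_right_0 (p : R) :
  p < 0 -> filterlim (fun x => Rpower x p) (at_right 0) (Rbar_locally p_infty).
Proof.
  intros Hp.
  apply (filterlim_comp _ _ _ (fun x => p * ln x) exp _ (Rbar_locally p_infty)).
  - apply (filterlim_comp _ _ _ ln (fun l => p * l) _ (Rbar_locally m_infty));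
      [exact is_lim_ln_0|].
    intros P [M HM]; exists (M / p); intros l Hl; apply HM.
    replace M with (p * (M / p)) by (field; lra); nra.
  - exact is_lim_exp_p.
Qed.

(** For [z > 0], [r] tends to [z], so its power has a finite limit whatever the sign of [1/2 + 3k],
    while [t] tends to [+oo], where [Lambda] vanishes. *)
Lemma vk_boundary (k : Z) (z : R) :
  0 < z -> filterlim (fun x => vk k x z) (at_right 0) (locally 0).
Proof.
  intros Hz; unfold vk.
  (* As a function of [w = x^(2/3)] the first factor is differentiable at [w = 0], because
     [z^2 > 0]. *)
  set (g := fun w => Rpower (sqrt (z ^ 2 + w)) (1/2 + 3 * IZR k)).
  replace (locally 0) with (locally (g 0 * 0)) by (f_equal; apply Rmult_0_r).
  apply (filterlim_comp_2 (fun x => g (Rpower x (2/3))) (fun x => Lambda k (z * Rpower x (-(1/3)))) Rmult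
           (G := locally (g 0)) (H := locally 0)).
  - apply (filterlim_comp _ _ _ (fun x => Rpower x (2/3)) g _ (locally 0));
      [apply filterlim_Rpower_at_right_0; lra|].
    apply (ex_derive_continuous g); unfold g, Rpower.
    assert (Hz2 : 0 < z ^ 2 + 0) by nra.
    auto_derive; repeat split; [exact Hz2|now apply sqrt_lt_R0].
  - apply (filterlim_comp _ _ _ (fun x => z * Rpower x (-(1/3))) (Lambda k) _ (Rbar_locally p_infty));
      [|exact (is_lim_Lambda_p_infty k)].
    apply (filterlim_comp _ _ _ (fun x => Rpower x (-(1/3))) (fun u => z * u) _ (Rbar_locally p_infty));
      [apply filterlim_Rpower_neg_at_right_0; lra|].
    intros P [M HM]; exists (M / z); intros u Hu; apply HM.
    apply Rlt_div_l in Hu; lra.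
  - exact (filterlim_mult (g 0) 0).
Qed.

Theorem proposition2p13 (k : Z) :
  (* Lambda_k is smooth on R *)
  (forall (n : nat) (t : R), ex_derive_n (Lambda k) n t) /\
  (* Lambda_k is bounded *)
  (exists B : R, forall t : R, Rabs (Lambda k t) <= B) /\
  (* limits at -oo and +oo *)
  is_lim (Lambda k) m_infty 1 /\
  is_lim (Lambda k) p_infty 0 /\
  (* v_k solves z d_x v - d_zz v = 0 on (0,oo) x R *)
  (forall x z : R, 0 < x ->
     ex_derive (fun x' => vk k x' z) x /\
     ex_derive (fun z' => vk k x z') z /\
     ex_derive (fun z' => Derive (fun z'' => vk k x z'') z') z /\
     z * Derive (fun x' => vk k x' z) x
       - Derive (fun z' => Derive (fun z'' => vk k x z'') z') z = 0) /\
  (* boundary condition v_k(0,z) = 0 for z > 0, as the limit x -> 0+ *)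
  (forall z : R, 0 < z ->
     filterlim (fun x => vk k x z) (at_right 0) (locally 0)).
Proof.
  split; [intros n t; apply smooth_upto_ex_derive_n, smooth_upto_Lambda|].
  assert (Hm := is_lim_Lambda_m_infty k); assert (Hp := is_lim_Lambda_p_infty k).
  split; [|split; [exact Hm|split; [exact Hp|split]]].
  - apply bounded_of_lim with 1 0; [|exact Hm|exact Hp].
    intros t; apply continuity_pt_filterlim, (ex_derive_continuous (Lambda k)).
    exact (smooth_upto_ex_derive_n 1 _ t (smooth_upto_Lambda k 1)).
  - exact (vk_pde k).
  - exact (vk_boundary k).
Qed.
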